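(* Let $X,Y\subset\mathbb{R}$ be compact intervals. Let $\mathcal{C}$ be a class of convex functions from $\mathbb{R}$ to $\mathbb{R}$ which is a universal approximator of continuous convex functions on compact subsets of $\mathbb{R}$ in the sup norm. Let $f:X\times Y\to\mathbb{R}$ be continuous, with $x\mapsto f(x,y)$ convex on $X$ for every fixed $y\in Y$ and $y\mapsto f(x,y)$ concave on $Y$ for every fixed $x\in X$, and suppose that, in the sense of distributions on $X\times Y$, either $\partial_{xx}(-\partial_{yy}f)\ge 0$ or $\partial_{xx}(-\partial_{yy}f)\le 0$. Then for every $\varepsilon>0$: (i) there exist $N\ge 1$ and a function $h$ in the saddle-network class of order $N$ on $X\times Y$ built from $\mathcal{C}$ such that $\sup_{(x,y)\in X\times Y}|f(x,y)-h(x,y)|<\varepsilon$; (ii) there exist $N\ge 1$ and a function $h$ in the bilinear saddle-network class of order $N$ on $X\times Y$ built from $\mathcal{C}$ such that $\sup_{(x,y)\in X\times Y}|f(x,y)-h(x,y)|<\varepsilon$. That is, both the saddle-network class and the bilinear saddle-network class (over all orders $N$) are dense in the sup norm in the class of continuous one-dimensional convex-concave functions satisfying either mixed Monge condition.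
   Context: Distributional inequalities: $\partial_{xx}(-\partial_{yy}f)\ge 0$ (respectively $\le 0$) in the sense of distributions on $X\times Y$ means that for every nonnegative smooth test function $\varphi$ compactly supported in the interior of $X\times Y$, $-\int_{X\times Y} f\,\partial_{xx}\partial_{yy}\varphi\,dx\,dy\ge 0$ (respectively $\le 0$). Universal approximator: for every compact interval $K\subset\mathbb{R}$, every continuous convex $g:K\to\mathbb{R}$ and every $\delta>0$ there is $\phi\in\mathcal{C}$ with $\sup_{t\in K}|g(t)-\phi(t)|<\delta$. Saddle class of order $N$ on $X\times Y$ (here in dimension one): the set of functions of the form $$\sum_{i=1}^N e_i^{cv,+}(x)a_i^{cc,+}(y)+\sum_{i=1}^N e_i^{cv,-}(x)a_i^{cv,+}(y)+H(x)+G(y),$$ where $e_i^{cv,+}:X\to[0,\infty)$ is convex, $e_i^{cv,-}:X\to(-\infty,0]$ is convex, $a_i^{cc,+}:Y\to[0,\infty)$ is concave, $a_i^{cv,+}:Y\to[0,\infty)$ is convex, $H:X\to\mathbb{R}$ is convex and $G:Y\to\mathbb{R}$ is concave. Bilinear saddle class of order $N$ on $X\times Y$ (in dimension one): the set of functions $g(x,y)+Bxy$ with $g$ in the saddle class of order $N$ and $B\in\mathbb{R}$. The saddle-network class (respectively bilinear saddle-network class) of order $N$ built from $\mathcal{C}$ is the subset of the saddle class (respectively bilinear saddle class) of order $N$ consisting of those functions admitting such a representation in which each convex function ($e_i^{cv,+}$, $e_i^{cv,-}$, $a_i^{cv,+}$, $H$) is the restriction to $X$ or $Y$ of an element of $\mathcal{C}$,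 and each concave function ($a_i^{cc,+}$, $G$) is the restriction to $Y$ of the negative of an element of $\mathcal{C}$. The sign constraints above are required to hold on $X$ or $Y$ respectively. *)

(* Defs.v *)
From HB Require Import structures.
From mathcomp Require Import all_boot all_order all_algebra.
From mathcomp Require Import all_classical all_reals all_analysis.

Set Implicit Arguments.
Unset Strict Implicit.
Unset Printing Implicit Defensive.

Import Order.TTheory GRing.Theory Num.Theory.
Import numFieldNormedType.Exports.

Local Open Scope classical_set_scope.
Local Open Scope ring_scope.

(* MathComp-Analysis, over an arbitrary realType R. Functions on a set D are
   represented by total functions of which only the values on D matter. *)

Definition convex_on (R : realType) (D : set R) (u : R -> R) : Prop :=
  @convex_function R R^o D u.

Definition concave_on (R : realType) (D : set R) (u : R -> R) : Prop :=
  convex_on D (fun t => - u t).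

(* The supremum is taken in \bar R, so that no boundedness is presupposed. *)
Definition sup_norm_on (R : realType) (T : Type) (D : set T) (u : T -> R)
    : \bar R :=
  ereal_sup [set `|u t|%:E | t in D].

Definition universal_approximator (R : realType) (C : set (R -> R)) : Prop :=
  forall (a b : R) (g : R -> R) (delta : R),
    a <= b ->
    {within `[a, b], continuous g} ->
    convex_on `[a, b] g ->
    0 < delta ->
    exists2 phi, C phi & (sup_norm_on `[a, b] (fun t => (g t - phi t)%R) < delta%:E)%E.

Definition partial_x (R : realType) (phi : R * R -> R) : R * R -> R :=
  fun z => 'D_(1, 0) phi z.

Definition partial_y (R : realType) (phi : R * R -> R) : R * R -> R :=
  fun z => 'D_(0, 1) phi z.

Fixpoint class_Ck (R : realType) (k : nat) (phi : R * R -> R) : Prop :=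
  if k is k'.+1 then
    [/\ continuous phi,
        forall z, derivable phi z (1, 0),
        forall z, derivable phi z (0, 1),
        class_Ck k' (partial_x phi) &
        class_Ck k' (partial_y phi)]
  else continuous phi.

Definition smooth (R : realType) (phi : R * R -> R) : Prop :=
  forall k, class_Ck k phi.

(* A test function supported in the interior of D is identified with its
   extension by zero to the plane. *)
Definition nonneg_test_function (R : realType) (D : set (R * R))
    (phi : R * R -> R) : Prop :=
  let supp := closure [set z | phi z != 0] in
  [/\ smooth phi, forall z, 0 <= phi z, compact supp & supp `<=` D^°].

(* The pairing of the distribution d_xx (- d_yy f) on X * Y with phi. *)
Definition mixed_pairing (R : realType) (X Y : set R) (f phi : R * R -> R)
    : R :=
  - \int[(@lebesgue_measure R \x @lebesgue_measure R)%E]_(z in X `*` Y)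
      (f z * partial_x (partial_x (partial_y (partial_y phi))) z).

Definition mixed_monge_ge0 (R : realType) (X Y : set R) (f : R * R -> R)
    : Prop :=
  forall phi, nonneg_test_function (X `*` Y) phi ->
    0 <= mixed_pairing X Y f phi.

Definition mixed_monge_le0 (R : realType) (X Y : set R) (f : R * R -> R)
    : Prop :=
  forall phi, nonneg_test_function (X `*` Y) phi ->
    mixed_pairing X Y f phi <= 0.

Record saddle_data (R : realType) (N : nat) := SaddleData {
  e_cvp : 'I_N -> R -> R;
  a_ccp : 'I_N -> R -> R;
  e_cvm : 'I_N -> R -> R;
  a_cvp : 'I_N -> R -> R;
  H_cv : R -> R;
  G_cc : R -> R }.

Definition saddle_eval (R : realType) (N : nat) (s : saddle_data R N)
    (z : R * R) : R :=
  \sum_(i < N) e_cvp s i z.1 * a_ccp s i z.2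
  + \sum_(i < N) e_cvm s i z.1 * a_cvp s i z.2
  + H_cv s z.1 + G_cc s z.2.

Definition saddle_admissible (R : realType) (X Y : set R) (N : nat)
    (s : saddle_data R N) : Prop :=
  [/\ forall i, convex_on X (e_cvp s i) /\ (forall x, X x -> 0 <= e_cvp s i x),
      forall i, concave_on Y (a_ccp s i) /\ (forall y, Y y -> 0 <= a_ccp s i y),
      forall i, convex_on X (e_cvm s i) /\ (forall x, X x -> e_cvm s i x <= 0),
      forall i, convex_on Y (a_cvp s i) /\ (forall y, Y y -> 0 <= a_cvp s i y) &
      convex_on X (H_cv s) /\ concave_on Y (G_cc s)].

Definition restriction_from (R : realType) (C : set (R -> R)) (D : set R)
    (u : R -> R) : Prop :=
  exists2 c, C c & forall t, D t -> u t = c t.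

Definition saddle_built_from (R : realType) (C : set (R -> R)) (X Y : set R)
    (N : nat) (s : saddle_data R N) : Prop :=
  [/\ forall i, restriction_from C X (e_cvp s i),
      forall i, restriction_from C Y (fun y => - a_ccp s i y),
      forall i, restriction_from C X (e_cvm s i),
      forall i, restriction_from C Y (a_cvp s i) &
      restriction_from C X (H_cv s) /\ restriction_from C Y (fun y => - G_cc s y)].

Definition saddle_class (R : realType) (X Y : set R) (N : nat)
    : set (R * R -> R) :=
  [set h | exists s : saddle_data R N,
     saddle_admissible X Y s /\
     forall z, (X `*` Y) z -> h z = saddle_eval s z].

Definition bilinear_saddle_class (R : realType) (X Y : set R) (N : nat)
    : set (R * R -> R) :=
  [set h | exists g, exists B : R, saddle_class X Y N g /\
     forall z, (X `*` Y) z -> h z = g z + B * z.1 * z.2].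

Definition saddle_network_class (R : realType) (C : set (R -> R))
    (X Y : set R) (N : nat) : set (R * R -> R) :=
  [set h | saddle_class X Y N h /\
     exists s : saddle_data R N,
       [/\ saddle_admissible X Y s, saddle_built_from C X Y s &
           forall z, (X `*` Y) z -> h z = saddle_eval s z]].

Definition bilinear_saddle_network_class (R : realType) (C : set (R -> R))
    (X Y : set R) (N : nat) : set (R * R -> R) :=
  [set h | bilinear_saddle_class X Y N h /\
     exists (s : saddle_data R N) (B : R),
       [/\ saddle_admissible X Y s, saddle_built_from C X Y s &
           forall z, (X `*` Y) z ->
             h z = saddle_eval s z + B * z.1 * z.2]].

(* Main.v *)
Require Import Defs.
From mathcomp Require Import all_boot all_order all_algebra.
From mathcomp Require Import all_classical all_reals all_analysis.
From mathcomp Require Import measurable_realfun.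
From mathcomp Require Import ring lra.
Import Order.TTheory GRing.Theory Num.Theory.
Import numFieldNormedType.Exports.
Local Open Scope classical_set_scope.
Local Open Scope ring_scope.
Set Implicit Arguments.
Unset Strict Implicit.
Unset Printing Implicit Defensive.

(** The proof expands f in one variable by piecewise linear interpolation. On a
    uniform mesh of [c, d], the interpolant of y |-> f (x, y) is
<<
      f (x, c) (d - y) / (d - c) + f (x, d) (y - c) / (d - c)
        + sum_j D_j (x) G_j (y),
>>
    where D_j (x) is minus the jump of slope at the j-th interior node and G_j is
    the Green kernel of the interval with pole at that node (interp_green). The
    kernels are nonnegative and concave. The D_j are nonnegative because f is
    concave in y, and they are convex in x as soon as the mixed second
    differences of f are nonpositive, which is the discrete form of the first
    mixed condition. After adding a constant to f (., c) and f (., d), every term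
    is a product of a nonnegative convex function of x and a nonnegative concave
    function of y (saddle_expansion), and uniform continuity makes the error
    small. For the second mixed condition the same expansion is applied to
    (y, x) |-> - f (x, y): it yields products of nonpositive convex functions of
    x and nonnegative convex functions of y (monge_le0_saddle).

    The discrete inequality is extracted from the distributional one in
    mixed_gap_le0. The test functions are products u (x) v (y), where u and v are
    second differences of a smooth convex function which is zero to the left and
    affine to the right of a small interval. Such second differences are
    nonnegative and compactly supported, and the mixed derivative of the product
    is a mixed second difference of small bumps; the pairing with f is therefore
    a smoothed mixed second difference of f. The bumps are built from the
    function exp (-1/t) and their primitives from the fundamental theorem of
    calculus. Contracting the points slightly towards the centre of the box keeps
    the supports in its interior and reaches boundary points by continuity.

    Finally the continuous factors are replaced by elements of C
    (saddle_network_approx); approximating from the correct side preserves the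
    sign constraints. The bilinear class contains the other one, with B = 0. *)

(** * Smooth functions of one variable *)

(** Existence of iterated derivatives, in a form that closes under sums and
    products by a plain induction on the order. *)
Fixpoint diff_times (R : realType) (k : nat) (u : R -> R) : Prop :=
  if k is k'.+1 then
    exists2 u' : R -> R, (forall x : R, is_derive x (1 : R) u (u' x)) & diff_times k' u'
  else True.

Section DiffTimes.
Context {R : realType}.
Implicit Types (u v : R -> R) (k : nat).

Lemma diff_timesW k u : diff_times k.+1 u -> diff_times k u.
Proof.
elim: k u => // k IH u [u' du Du']; exists u' => //; exact: IH.
Qed.

Lemma diff_timesD k u v :
  diff_times k u -> diff_times k v -> diff_times k (fun x => u x + v x).
Proof.
elim: k u v => // k IH u v [u' du Du'] [v' dv Dv'].
exists (fun x => u' x + v' x); last exact: IH.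
by move=> x; apply: is_deriveD.
Qed.

Lemma diff_times_cst k (c : R) : diff_times k (fun _ => c).
Proof.
elim: k c => // k IH c; exists (fun=> 0); last exact: IH.
by move=> x; apply: is_derive_cst.
Qed.

Lemma diff_timesM k u v :
  diff_times k u -> diff_times k v -> diff_times k (fun x => u x * v x).
Proof.
elim: k u v => // k IH u v Du Dv.
move: (diff_timesW Du) (diff_timesW Dv) => Du0 Dv0.
case: Du Dv => [u' du Du'] [v' dv Dv'].
exists (fun x => u x * v' x + v x * u' x).
  by move=> x; apply: is_deriveM.
by apply: diff_timesD; apply: IH.
Qed.

Lemma diff_timesZ k (c : R) u :
  diff_times k u -> diff_times k (fun x => c * u x).
Proof. by apply: diff_timesM; apply: diff_times_cst. Qed.

Lemma is_derive_affine (s t x : R) : is_derive x (1 : R) (fun y => s * y + t) s.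
Proof.
have h1 : is_derive x (1 : R) (cst s * id + cst t : R -> R)
    (s *: 1 + x *: 0 + 0) by apply: is_deriveD.
by apply: is_derive_eq h1 _; rewrite /GRing.scale /=; ring.
Qed.

Lemma is_derive_comp_affine u (s t x d : R) :
  is_derive (s * x + t) 1 u d -> is_derive x (1 : R) (fun y => u (s * y + t)) (s * d).
Proof.
move=> du; rewrite mulrC.
by apply: (@is_derive1_comp _ u (fun y => s * y + t)) => //; apply: is_derive_affine.
Qed.

Lemma diff_times_comp_affine k u (s t : R) :
  diff_times k u -> diff_times k (fun x => u (s * x + t)).
Proof.
elim: k u => // k IH u [u' du Du'].
exists (fun x => s * u' (s * x + t)).
  by move=> x; apply: is_derive_comp_affine.
by apply: diff_timesZ; apply: IH.
Qed.

Lemma diff_times_sum k (I : Type) (r : seq I) (u : I -> R -> R) :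
  (forall i, diff_times k (u i)) -> diff_times k (fun x => \sum_(i <- r) u i x).
Proof.
move=> Du; elim: r => [|i r IH].
  under eq_fun do rewrite big_nil; exact: diff_times_cst.
by under eq_fun do rewrite big_cons; apply: diff_timesD.
Qed.

End DiffTimes.

(** * A smooth function that is flat at the origin *)

Section Flat.
Context {R : realType}.

(** The family t^-n exp (-1/t), extended by zero to t <= 0. Keeping all the
    powers t^-n makes the family stable under differentiation, up to linear
    combinations, so that smoothness needs no polynomial bookkeeping. *)
Definition flat (n : nat) (t : R) : R :=
  if t <= 0 then 0 else t^-1 ^+ n * expR (- t^-1).

Lemma flat_le0 n t : t <= 0 -> flat n t = 0.
Proof. by rewrite /flat => ->. Qed.

Lemma flat_gt0 n t : 0 < t -> 0 < flat n t.
Proof.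
by move=> t0; rewrite /flat (leNgt _ 0) t0 /= mulr_gt0 ?expR_gt0 // exprn_gt0 // invr_gt0.
Qed.

Lemma flat_ge0 n t : 0 <= flat n t.
Proof.
by have [/flat_le0 ->//|/flat_gt0 t0] := leP t 0; apply/ltW.
Qed.

(** The exponential beats the power: exp (1/t) dominates its Taylor term of
    order n+1. This gives continuity at the origin and, since
    flat n t = flat n.+1 t * t, differentiability there. *)
Lemma flat_le n t : flat n t <= (n.+1)`!%:R * `|t|.
Proof.
have [t0|t0] := leP t 0; first by rewrite flat_le0 // mulr_ge0.
rewrite gtr0_norm // /flat (leNgt t) t0 /= expRN.
rewrite ler_pdivrMr ?expR_gt0 // exprVn.
have s0 : 0 <= t^-1 by rewrite invr_ge0 ltW.
apply: (@le_trans _ _ ((n.+1)`!%:R * t * (t^-1 ^+ n.+1 / (n.+1)`!%:R))).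
  rewrite exprS exprVn le_eqVlt; apply/orP; left; apply/eqP.
  by field; rewrite !(gt_eqF t0) /= expf_neq0 ?(gt_eqF t0) //= pnatr_eq0 -lt0n fact_gt0.
rewrite ler_wpM2l // ?mulr_ge0 // ?ltW //.
rewrite (lt_le_trans _ (expR_ge1Dxn n s0)) // ltrDr //.
Qed.

Lemma is_derive_flat n (t : R) :
  is_derive t (1 : R) (flat n) (- n%:R * flat n.+1 t + flat n.+2 t).
Proof.
have [t0|t0|->] := ltgtP t 0.
- rewrite !(flat_le0 _ (ltW t0)) mulr0 addr0.
  apply: (@near_eq_is_derive _ _ _ (cst (0 : R))).
  by near=> s; rewrite flat_le0 //; apply: ltW; near: s; apply: lt_nbhsl.
- apply: (@near_eq_is_derive _ _ _ ((fun s => s^-1)^+n * (expR \o (fun s => - s^-1)))).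
    near=> s; rewrite /flat (leNgt _ 0) (_ : 0 < s) /=; last by near: s; apply: lt_nbhsr.
    by rewrite fctE /= exprfctE.
  have tn0 : t != 0 by rewrite gt_eqF.
  have dV : is_derive t (1 : R) (fun s : R => s^-1) (- t ^- 2 *: 1) by apply: is_deriveV.
  have dE : is_derive t (1 : R) (expR \o (fun s : R => - s^-1))
     (expR (- t^-1) * - (- t ^- 2 *: 1)) by apply: is_derive1_comp.
  have dX := is_deriveX n dV.
  apply: is_derive_eq.
  rewrite /flat (leNgt _ 0) t0 /= exprfctE /GRing.scale /=.
  case: n {dX} => [|n] /=; rewrite ?expr0 ?exprS; field => //.
- rewrite !flat_le0 // mulr0 addr0.
  apply/is_derive1_caratheodory; exists (flat n.+1); split.
  + move=> z; rewrite (flat_le0 n (lexx 0)) !subr0 /flat; case: ifPn => z0.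
      by rewrite mul0r.
    by rewrite exprS; field; move: z0; rewrite -ltNge => /gt_eqF ->.
  + apply/cvgrPdist_le => e e0 /=.
    rewrite (flat_le0 _ (lexx 0)).
    near=> s; rewrite sub0r normrN ger0_norm ?flat_ge0 //.
    apply: (le_trans (flat_le _ _)).
    rewrite mulrC -ler_pdivlMr ?ltr0n ?fact_gt0 //.
    near: s; apply: cvgr0_norm_le; first exact: cvg_id.
    by rewrite divr_gt0 // ltr0n fact_gt0.
  + by rewrite flat_le0.
Unshelve. all: by end_near. Qed.

Lemma diff_times_flat k n : diff_times k (flat n).
Proof.
elim: k n => // k IH n; exists (fun t => - n%:R * flat n.+1 t + flat n.+2 t).
  by move=> x; apply: is_derive_flat.
by apply: diff_timesD; first apply: diff_timesZ.
Qed.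

End Flat.

(** * Mollifiers with two smooth primitives *)

Section Mollifier.
Context {R : realType}.
Local Notation mu := (@lebesgue_measure R).

Lemma is_derive_continuous (u u' : R -> R) :
  (forall x : R, is_derive x (1 : R) u (u' x)) -> continuous u.
Proof.
move=> du x; apply/differentiable_continuous/derivable1_diffP.
exact: (@ex_derive _ _ _ _ _ _ _ (du x)).
Qed.

Lemma is_derive_within_continuous (u u' : R -> R) (D : set R) :
  (forall x : R, is_derive x (1 : R) u (u' x)) -> {within D, continuous u}.
Proof.
by move=> du; apply: continuous_subspaceT; exact: is_derive_continuous du.
Qed.

Lemma antiderivative_from0 (r : R -> R) :
  continuous r -> (forall t, t <= 0 -> r t = 0) ->
  exists2 F : R -> R, (forall x : R, is_derive x (1 : R) F (r x)) &
                      (forall t, t <= 0 -> F t = 0).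
Proof.
move=> rc r0; pose F x := \int[mu]_(t in `[-1, x]) r t.
have F0 t : t <= 0 -> F t = 0.
  move=> t0; rewrite /F.
  rewrite (@eq_Rintegral _ _ _ mu _ (cst 0)); last first.
    move=> s; rewrite inE /= in_itv /= => /andP[_ st].
    by rewrite r0 // (le_trans st).
  by rewrite Rintegral_cst // mul0r.
(* The lower bound -1 of the integral leaves room for a two-sided derivative
   at 0; to the left of 0 the primitive vanishes identically. *)
exists F => // x; have [x0|x0] := ltP x 0.
  rewrite r0 ?(ltW x0) //.
  apply: (@near_eq_is_derive _ _ _ (cst (0 : R))).
  by near=> s; rewrite F0 //; apply/ltW; near: s; apply: lt_nbhsl.
have [||||dF <-] := @continuous_FTC1 R r (BLeft (-1)) x (x + 1).
- by rewrite ltrDl.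
- apply: continuous_compact_integrable; first exact: segment_compact.
  exact: continuous_subspaceT.
- by rewrite (_ : (_ < _)%O = ((-1 : R) < x)%R) ?bnd_simp //; lra.
- exact: rc.
by rewrite derive1E; apply/derivableP.
Unshelve. all: by end_near. Qed.

Lemma diff_times_antiderivative k (u u' : R -> R) :
  (forall x : R, is_derive x (1 : R) u (u' x)) ->
  (forall j, diff_times j u') -> diff_times k u.
Proof. by move=> du Du'; case: k => // k; exists u'. Qed.

(** A smooth bump mol0 carried by [0, e] together with its first and second
    primitives mol1 and mol2 that vanish to the left of 0. The second primitive
    is convex, and affine outside [0, e]: a smoothed positive part. Hence its
    second differences are nonnegative and compactly supported, which makes
    them test functions whose second derivatives are second differences of
    bumps. *)
Record mollifier (e : R) := Mollifier {
  mol2 : R -> R;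
  mol1 : R -> R;
  mol0 : R -> R;
  mol_mass : R;
  mol_mass_gt0 : 0 < mol_mass;
  mol2_is_derive : forall x : R, is_derive x (1 : R) mol2 (mol1 x);
  mol1_is_derive : forall x : R, is_derive x (1 : R) mol1 (mol0 x);
  mol2_smooth : forall k, diff_times k mol2;
  mol0_smooth : forall k, diff_times k mol0;
  mol0_ge0 : forall t, 0 <= mol0 t;
  mol2_le0 : forall t, t <= 0 -> mol2 t = 0;
  mol1_le0 : forall t, t <= 0 -> mol1 t = 0;
  mol0_le0 : forall t, t <= 0 -> mol0 t = 0;
  mol1_ge : forall t, e <= t -> mol1 t = mol_mass;
  mol0_ge : forall t, e <= t -> mol0 t = 0 }.

Lemma mollifier_exists (e : R) : 0 < e -> exists P : mollifier e, True.
Proof.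
move=> e0.
(* The product of a function flat at 0 and its mirror image about e / 2. *)
pose r t := flat 0 t * flat 0 ((-1) * t + e).
have rS k : diff_times k r.
  apply: diff_timesM; first exact: diff_times_flat.
  by apply: diff_times_comp_affine; exact: diff_times_flat.
have rc : continuous r.
  have [r' dr _] := rS 1%N; exact: is_derive_continuous dr.
have r0 t : t <= 0 -> r t = 0 by move=> t0; rewrite /r flat_le0 // mul0r.
have r1 t : e <= t -> r t = 0.
  by move=> te; rewrite /r (@flat_le0 _ _ (-1 * t + e)) ?mulr0 //; lra.
have rge0 t : 0 <= r t by rewrite mulr_ge0 // flat_ge0.
have [Q dQ Q0] := antiderivative_from0 rc r0.
have [P dP P0] := antiderivative_from0 (is_derive_continuous dQ) Q0.
have Q1 t : e <= t -> Q t = Q e.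
  rewrite le_eqVlt => /predU1P[->//|et].
  have [c] := @MVT R Q r e t et (fun x _ => dQ x)
    (is_derive_within_continuous dQ).
  rewrite in_itv /= => /andP[ec _]; rewrite r1 ?(ltW ec) // mul0r.
  by move/eqP; rewrite subr_eq0 => /eqP.
have Qe : 0 < Q e.
  have [c] := @MVT R Q r 0 e e0 (fun x _ => dQ x)
    (is_derive_within_continuous dQ).
  rewrite in_itv /= => /andP[c0 ce]; rewrite (Q0 0) // !subr0 => ->.
  by rewrite mulr_gt0 // /r mulr_gt0 // flat_gt0 //; lra.
have QS k : diff_times k Q by apply: diff_times_antiderivative dQ _.
by exists (Mollifier Qe dP dQ (fun k => diff_times_antiderivative k dP QS)
  rS rge0 P0 Q0 r0 Q1 r1).
Qed.

End Mollifier.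

(** * Test functions of product form *)

Section Tensor.
Context {R : realType}.

Lemma partial_x_tensor (u u' v : R -> R) :
  (forall x : R, is_derive x (1 : R) u (u' x)) ->
  (forall z, derivable (fun z : R * R => u z.1 * v z.2) z (1, 0)) /\
  partial_x (fun z : R * R => u z.1 * v z.2) = fun z => u' z.1 * v z.2.
Proof.
move=> du.
have key z : (fun h : R => h^-1 *: (((fun z : R * R => u z.1 * v z.2) \o shift z)
    (h *: ((1 : R), (0 : R)) : R * R) - u z.1 * v z.2)) @ 0^' --> u' z.1 * v z.2.
  have [d1 d2] := du z.1.
  rewrite (_ : (fun h => _) = (fun h : R =>
      (h^-1 *: ((u \o shift z.1) (h *: (1:R)) - u z.1)) * v z.2)); last first.
    apply/funext => h /=; rewrite /shift /= /GRing.scale /= mulr0 add0r.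
    by rewrite -mulrA mulrBl.
  apply: cvgMr_tmp.
  by rewrite -d2; exact: d1.
split=> [z|]; first by apply/cvg_ex; exists (u' z.1 * v z.2); exact: key.
by apply/funext => z; apply/cvg_lim; [exact: Rhausdorff|exact: key].
Qed.

Lemma partial_y_tensor (u v v' : R -> R) :
  (forall x : R, is_derive x (1 : R) v (v' x)) ->
  (forall z, derivable (fun z : R * R => u z.1 * v z.2) z (0, 1)) /\
  partial_y (fun z : R * R => u z.1 * v z.2) = fun z => u z.1 * v' z.2.
Proof.
move=> dv.
have key z : (fun h : R => h^-1 *: (((fun z : R * R => u z.1 * v z.2) \o shift z)
    (h *: ((0 : R), (1 : R)) : R * R) - u z.1 * v z.2)) @ 0^' --> u z.1 * v' z.2.
  have [d1 d2] := dv z.2.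
  rewrite (_ : (fun h => _) = (fun h : R =>
      u z.1 * (h^-1 *: ((v \o shift z.2) (h *: (1:R)) - v z.2)))); last first.
    apply/funext => h /=; rewrite /shift /= /GRing.scale /= mulr0 add0r.
    by rewrite mulrCA -mulrBr.
  apply: cvgMl_tmp.
  by rewrite -d2; exact: d1.
split=> [z|]; first by apply/cvg_ex; exists (u z.1 * v' z.2); exact: key.
by apply/funext => z; apply/cvg_lim; [exact: Rhausdorff|exact: key].
Qed.

Lemma continuous_tensor (u v : R -> R) :
  continuous u -> continuous v -> continuous (fun z : R * R => u z.1 * v z.2).
Proof.
move=> cu cv z; apply: (@cvgM _ _ _ _ (fun z : R * R => u z.1) (fun z : R * R => v z.2)).
- by apply: (@continuous_comp _ _ _ (fst : R * R -> R) u); [exact: cvg_fst|exact: cu].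
- by apply: (@continuous_comp _ _ _ (snd : R * R -> R) v); [exact: cvg_snd|exact: cv].
Qed.

Lemma class_Ck_tensor k (u v : R -> R) :
  diff_times k.+1 u -> diff_times k.+1 v ->
  class_Ck k (fun z : R * R => u z.1 * v z.2).
Proof.
elim: k u v => [|k IH] u v Du Dv.
  case: Du Dv => [u' du _] [v' dv _].
  by apply: continuous_tensor; [exact: is_derive_continuous du|exact: is_derive_continuous dv].
move: (diff_timesW Du) (diff_timesW Dv) => Du0 Dv0.
case: Du Dv => [u' du Du'] [v' dv Dv'].
have [dx px] := partial_x_tensor v du.
have [dy py] := partial_y_tensor u dv.
split=> //.
- by apply: continuous_tensor; [exact: is_derive_continuous du|exact: is_derive_continuous dv].
- by rewrite px; apply: IH.
- by rewrite py; apply: IH.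
Qed.

Lemma mixed_partial_tensor (u u1 u2 v v1 v2 : R -> R) :
  (forall x : R, is_derive x (1 : R) u (u1 x)) ->
  (forall x : R, is_derive x (1 : R) u1 (u2 x)) ->
  (forall x : R, is_derive x (1 : R) v (v1 x)) ->
  (forall x : R, is_derive x (1 : R) v1 (v2 x)) ->
  partial_x (partial_x (partial_y (partial_y (fun z : R * R => u z.1 * v z.2))))
  = fun z => u2 z.1 * v2 z.2.
Proof.
move=> du du1 dv dv1.
rewrite (partial_y_tensor u dv).2 (partial_y_tensor u dv1).2.
by rewrite (partial_x_tensor v2 du).2 (partial_x_tensor v2 du1).2.
Qed.

Lemma nonneg_test_tensor (a b c d x0 x1 y0 y1 : R) (u v : R -> R) :
  a < x0 -> x1 < b -> c < y0 -> y1 < d ->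
  (forall k, diff_times k u) -> (forall k, diff_times k v) ->
  (forall x, 0 <= u x) -> (forall y, 0 <= v y) ->
  (forall x, u x != 0 -> x0 <= x <= x1) ->
  (forall y, v y != 0 -> y0 <= y <= y1) ->
  nonneg_test_function (`[a, b] `*` `[c, d]) (fun z : R * R => u z.1 * v z.2).
Proof.
move=> ax xb cy yd Du Dv u0 v0 us vs.
have cl : closure [set z : R * R | u z.1 * v z.2 != 0] `<=` `[x0, x1] `*` `[y0, y1].
  rewrite closureE; apply: smallest_sub.
    apply: (@closedI _ (fst @^-1` `[x0, x1]%classic) (snd @^-1` `[y0, y1]%classic)).
      by apply: preimage_closed (@itv_closed _ _ _ _) => z _; exact: cvg_fst.
    by apply: preimage_closed (@itv_closed _ _ _ _) => z _; exact: cvg_snd.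
  move=> z /=; rewrite mulf_eq0 negb_or => /andP[/us zu /vs zv].
  by split; rewrite /= in_itv.
split.
- by move=> k; apply: class_Ck_tensor.
- by move=> z; rewrite mulr_ge0.
- apply: (subclosed_compact (@closed_closure _ _) _ cl).
  by apply: compact_setX; exact: segment_compact.
- apply: (subset_trans cl).
  apply: (@subset_trans _ (`]a, b[ `*` `]c, d[)).
    by apply: setSX => s /=; rewrite !in_itv /= => /andP[s0 s1]; apply/andP; lra.
  rewrite -open_subsetE; first by apply: setSX => //; exact: subset_itv_oo_cc.
  apply: (@openI _ (fst @^-1` `]a, b[%classic) (snd @^-1` `]c, d[%classic)).
    by apply: open_comp (itv_open _ _) => z _; exact: cvg_fst.
  by apply: open_comp (itv_open _ _) => z _; exact: cvg_snd.
Qed.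

End Tensor.

(** * Piecewise linear interpolation and its Green kernels *)

Section Interpolation.
Context {R : realType}.
Variables (c d : R) (n : nat).
Hypothesis cd : c < d.

Definition mesh : R := (d - c) / n.+1%:R.
Definition node (j : nat) : R := c + j%:R * mesh.
Definition ramp (j : nat) (y : R) : R := Num.max 0 (y - node j).

(** Each summand is affine on one cell and constant elsewhere, so that partial
    sums are again interpolants and properties can be shown cell by cell. *)
Definition interp (u : R -> R) (y : R) : R :=
  u c + \sum_(j < n.+1)
    (u (node j.+1) - u (node j)) / mesh * (ramp j y - ramp j.+1 y).

(** Minus the jump of slope of the interpolant at the node j.+1. *)
Definition concavity (u : R -> R) (j : nat) : R :=
  (2 * u (node j.+1) - u (node j) - u (node j.+2)) / mesh.

(** The Green kernel of minus the second derivative on [c, d] with zero boundary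
    values, with pole at the node j.+1. *)
Definition green (j : nat) (y : R) : R :=
  (y - c) * ((d - node j.+1) / (d - c)) - ramp j.+1 y.

Lemma mesh_gt0 : 0 < mesh.
Proof using cd. by rewrite divr_gt0 ?subr_gt0 ?ltr0n. Qed.

Lemma node0 : node 0 = c.
Proof. by rewrite /node mul0r addr0. Qed.

Lemma nodeS j : node j.+1 = node j + mesh.
Proof. by rewrite /node -natr1; ring. Qed.

Lemma node_last : node n.+1 = d.
Proof. by rewrite /node /mesh; field; rewrite addrC natr1 pnatr_eq0. Qed.

Lemma node_le : {homo node : i j / (i <= j)%N >-> i <= j}.
Proof using cd. by move=> i j ij; rewrite lerD2l ler_pM2r ?mesh_gt0 // ler_nat. Qed.

Lemma node_in j : (j <= n.+1)%N -> c <= node j <= d.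
Proof using cd.
by move=> jn; rewrite -{1}node0 -node_last !node_le.
Qed.

Lemma ramp_above j y : node j <= y -> ramp j y = y - node j.
Proof. by move=> jy; rewrite /ramp; apply/max_idPr; rewrite subr_ge0. Qed.

Lemma ramp_below j y : y <= node j -> ramp j y = 0.
Proof. by move=> jy; rewrite /ramp; apply/max_idPl; rewrite subr_le0. Qed.

Lemma interp_telescope (u : R -> R) k y : node k <= y ->
  u c + \sum_(j < k)
    (u (node j.+1) - u (node j)) / mesh * (ramp j y - ramp j.+1 y) = u (node k).
Proof using cd.
elim: k => [|k IH] ky; first by rewrite big_ord0 addr0 node0.
rewrite big_ord_recr /= addrA IH; last by rewrite (le_trans _ ky) // node_le.
rewrite !ramp_above // ?(le_trans _ ky) ?node_le // nodeS.
by have := mesh_gt0 => h0; field; rewrite gt_eqF.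
Qed.

(** Induction on the number of cells: to the right of a node the part of the
    sum before it telescopes to the value at this node, so in the next cell the
    interpolant is a convex combination of two neighbouring values. *)
Lemma interp_close (u : R -> R) (eta : R) :
  (forall s t, c <= s <= d -> c <= t <= d -> `|s - t| <= mesh ->
     `|u s - u t| <= eta) ->
  forall y, c <= y <= d -> `|interp u y - u y| <= eta.
Proof using cd.
move=> osc y /andP[cy yd]; have h0 := mesh_gt0.
have cc : c <= c <= d by lra.
have eta0 : 0 <= eta.
  by apply: le_trans (osc c c cc cc _); rewrite ?subrr ?normr0 // ltW.
suff H k : (k <= n.+1)%N -> y <= node k -> `|u c + \sum_(j < k)
    (u (node j.+1) - u (node j)) / mesh * (ramp j y - ramp j.+1 y) - u y| <= eta.
  by apply: H => //; rewrite node_last.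
elim: k => [_|k IH kn].
  rewrite node0 => yc; have -> : y = c by lra.
  by rewrite big_ord0 addr0 subrr normr0.
have [yk _|ky yk] := leP y (node k).
  rewrite big_ord_recr /= !ramp_below ?(le_trans yk) ?node_le //.
  by rewrite subrr mulr0 addr0 IH // ltnW.
rewrite big_ord_recr /= addrA interp_telescope ?(ltW ky) //.
rewrite (ramp_above (ltW ky)) (ramp_below yk) subr0.
have /andP[k0 k1] := node_in (ltnW kn).
have /andP[k2 k3] := node_in kn.
move: (yk); rewrite nodeS => yk'.
have o1 : `|u (node k) - u y| <= eta.
  by apply: osc; rewrite ?k0 ?k1 ?cy ?yd // ler_norml; lra.
have o2 : `|u (node k.+1) - u y| <= eta.
  by apply: osc; rewrite ?k2 ?k3 ?cy ?yd // ler_norml nodeS; lra.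
pose th := (y - node k) / mesh.
have th0 : 0 <= th by rewrite divr_ge0 ?(ltW h0) // subr_ge0 ltW.
have th1 : th <= 1 by rewrite ler_pdivrMr // mul1r; lra.
rewrite (_ : _ - u y = (1 - th) * (u (node k) - u y) + th * (u (node k.+1) - u y));
  last by rewrite /th nodeS; field; rewrite gt_eqF.
apply: (le_trans (ler_normD _ _)); rewrite 2!normrM.
rewrite (ger0_norm th0) (@ger0_norm _ (1 - th)) ?subr_ge0 //.
have -> : eta = (1 - th) * eta + th * eta by ring.
by apply: lerD; apply: ler_wpM2l; rewrite ?subr_ge0.
Qed.

(** Summation by parts turns the slopes into jumps of slope. *)
Lemma interp_ramps (u : R -> R) y : c <= y <= d ->
  interp u y = u c + (u (node 1) - u c) / mesh * (y - c)
    - \sum_(j < n) concavity u j * ramp j.+1 y.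
Proof using cd.
move=> /andP[cy yd]; have h0 := mesh_gt0.
pose s j := (u (node j.+1) - u (node j)) / mesh.
have H k : \sum_(j < k.+1) s j * (ramp j y - ramp j.+1 y) =
   s 0%N * ramp 0 y - \sum_(j < k) concavity u j * ramp j.+1 y - s k * ramp k.+1 y.
  elim: k => [|k IH]; first by rewrite big_ord_recr !big_ord0 /=; ring.
  rewrite big_ord_recr /= IH [in RHS]big_ord_recr /= /s /concavity.
  by field; rewrite gt_eqF.
rewrite /interp H (@ramp_below n.+1) ?node_last // mulr0 subr0.
by rewrite ramp_above ?node0 // /s node0 addrA.
Qed.

(** The slope at c is eliminated by evaluating the previous formula at y = d;
    this replaces the ramps by the Green kernels and the tangent at c by the
    chord from c to d. *)
Lemma interp_green (u : R -> R) y : c <= y <= d ->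
  interp u y = u c * ((d - y) / (d - c)) + u d * ((y - c) / (d - c))
    + \sum_(j < n) concavity u j * green j y.
Proof using cd.
move=> cyd.
have cdn : d - c != 0 by rewrite subr_eq0 gt_eqF.
have Ed : u d = u c + (u (node 1) - u c) / mesh * (d - c)
    - \sum_(j < n) concavity u j * (d - node j.+1).
  transitivity (interp u d).
    by rewrite /interp interp_telescope node_last.
  rewrite interp_ramps; last by lra.
  congr (_ - _); apply: eq_bigr => j _; congr (_ * _).
  by rewrite ramp_above //; have /andP[] : c <= node j.+1 <= d by apply: node_in; rewrite ltnS ltnW.
rewrite interp_ramps //.
have -> : \sum_(j < n) concavity u j * green j y =
    (y - c) / (d - c) * (\sum_(j < n) concavity u j * (d - node j.+1))
    - \sum_(j < n) concavity u j * ramp j.+1 y.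
  rewrite big_distrr /= -sumrB; apply: eq_bigr => j _; rewrite /green.
  by field.
rewrite Ed; field; rewrite cdn /=; exact/lt0r_neq0/mesh_gt0.
Qed.

(** As a minimum of two affine functions that are nonnegative on [c, d], the
    kernel is visibly nonnegative there. *)
Lemma greenE j y : (j < n)%N -> c <= y <= d ->
  green j y = Num.min ((y - c) * ((d - node j.+1) / (d - c)))
                      ((d - y) * ((node j.+1 - c) / (d - c))).
Proof using cd.
move=> jn _.
have cdn : d - c != 0 by rewrite subr_eq0 gt_eqF.
have E : (d - y) * ((node j.+1 - c) / (d - c))
     = (y - c) * ((d - node j.+1) / (d - c)) - (y - node j.+1) by field.
rewrite E /green; move: (_ * (_ / _)) => A; have [yj|jy] := leP y (node j.+1).
  by rewrite ramp_below // subr0; apply/esym/min_idPl; lra.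
by rewrite ramp_above ?(ltW jy) //; apply/esym/min_idPr; lra.
Qed.

Lemma green_ge0 j y : (j < n)%N -> c <= y <= d -> 0 <= green j y.
Proof using cd.
move=> jn cyd; rewrite greenE // le_min; case/andP: cyd => cy yd.
have /andP[cj jd] := @node_in j.+1 (leqW jn).
by apply/andP; split; apply: mulr_ge0; rewrite ?divr_ge0 ?subr_ge0 // ltW.
Qed.

End Interpolation.

(** * Continuous functions on a compact box *)

Section Compactness.
Context {R : realType}.

Lemma compact_unif_continuous (T : pseudoMetricType R) (K : set T) (f : T -> R) :
  compact K -> {within K, continuous f} -> forall eta : R, 0 < eta ->
  exists2 delta : R, 0 < delta &
    forall z z', K z -> K z' -> ball z delta z' -> `|f z - f z'| <= eta.
Proof.
move=> cK /subspace_continuousP cf eta eta0.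
have e20 : 0 < eta / 2 by rewrite divr_gt0.
pose good (delta : R) (z : T) := K z -> forall z', K z' ->
  ball z delta z' -> `|f z - f z'| <= eta.
have Hn : \forall delta \near 0^'+, K `<=` good delta.
  move/compact_near_coveringP: cK; apply => x Kx.
  have /cvgrPdist_le/(_ _ e20) := cf x Kx.
  rewrite near_withinE => /nbhs_ballP[r /= r0 fr].
  have r20 : 0 < r / 2 by rewrite divr_gt0.
  exists (ball x (r / 2), [set delta | delta < r / 2]) => /=.
    split; first exact: nbhsx_ballx.
    exact: nbhs_right_lt.
  move=> [z delta] /= [xz dr] Kz z' Kz' zz'.
  have fz := fr z (le_ball _ xz) Kz.
  have fz' := fr z' _ Kz'.
  have {}fz : `|f x - f z| <= eta / 2 by apply: fz; lra.
  have {}fz' : `|f x - f z'| <= eta / 2.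
    apply: fz'; rewrite (splitr r); apply: ball_triangle xz _.
    by apply: le_ball zz'; exact: ltW.
  rewrite (_ : f z - f z' = (f x - f z') - (f x - f z)); last by ring.
  by rewrite (le_trans (ler_normB _ _)) //; lra.
have : \forall delta \near 0^'+, 0 < delta /\ K `<=` good delta.
  by near=> delta; split; near: delta; [exact: nbhs_right_gt|exact: Hn].
case/filter_ex => delta [d0 H]; exists delta => // z z' Kz Kz'.
exact: H.
Unshelve. all: by end_near. Qed.

Lemma compact_bounded_fun (T : pseudoMetricType R) (K : set T) (f : T -> R) :
  compact K -> {within K, continuous f} ->
  exists2 M : R, 0 <= M & forall z, K z -> `|f z| <= M.
Proof.
move=> cK cf.
have /compact_bounded[M [Mr HM]] := continuous_compact cf cK.
exists (`|M| + 1); first by rewrite addr_ge0.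
move=> z Kz; apply: (HM (`|M| + 1)); last by exists z.
by rewrite (le_lt_trans (ler_norm M)) // ltrDl.
Qed.

Lemma within_continuous_dist (K : set R) (g : R -> R) :
  (forall eta : R, 0 < eta -> exists2 delta : R, 0 < delta &
     forall s t, K s -> K t -> `|s - t| < delta -> `|g s - g t| <= eta) ->
  {within K, continuous g}.
Proof.
move=> H; apply/subspace_continuousP => x Kx; apply/cvgrPdist_le => eta /H[delta d0 Hd].
rewrite near_withinE; apply/nbhs_ballP; exists delta => //= s xs Ks.
exact: Hd.
Qed.

Variables (a b c d : R) (f : R * R -> R).
Hypothesis fc : {within `[a, b] `*` `[c, d], continuous f}.

Lemma box_unif_continuous (eta : R) : 0 < eta ->
  exists2 delta : R, 0 < delta & forall x x' y y',
    a <= x <= b -> a <= x' <= b -> c <= y <= d -> c <= y' <= d ->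
    `|x - x'| < delta -> `|y - y'| < delta -> `|f (x, y) - f (x', y')| <= eta.
Proof using fc.
move=> eta0.
have cK : compact (`[a, b]%classic `*` `[c, d]%classic).
  by apply: compact_setX; exact: segment_compact.
have [delta d0 H] := compact_unif_continuous cK fc eta0.
exists delta => // x x' y y' xab x'ab ycd y'cd xx yy.
by apply: H; split => //=; rewrite in_itv.
Qed.

Lemma box_continuous_x y : c <= y <= d ->
  {within `[a, b], continuous (fun x => f (x, y))}.
Proof using fc.
move=> ycd; apply: within_continuous_dist => eta /box_unif_continuous[delta d0 H].
exists delta => // s t; rewrite /= !in_itv /= => sab tab st; apply: H => //.
by rewrite subrr normr0.
Qed.

Lemma box_bounded : exists2 M : R, 0 <= M &
  forall x y, a <= x <= b -> c <= y <= d -> `|f (x, y)| <= M.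
Proof using fc.
have cK : compact (`[a, b]%classic `*` `[c, d]%classic).
  by apply: compact_setX; exact: segment_compact.
have [M M0 H] := compact_bounded_fun cK fc.
by exists M => // x y xab ycd; apply: H; split => //=; rewrite in_itv.
Qed.

Lemma interp_unif_close (eta : R) : c < d -> 0 < eta ->
  exists n0, forall n, (n0 <= n)%N -> forall x y, a <= x <= b -> c <= y <= d ->
    `|interp c d n (fun t => f (x, t)) y - f (x, y)| <= eta.
Proof using fc.
move=> cd eta0; have [delta d0 H] := box_unif_continuous eta0.
have q0 : 0 <= (d - c) / delta by rewrite divr_ge0 ?subr_ge0 // ltW.
exists (Num.truncn ((d - c) / delta)) => n nn x y xab ycd.
apply: (interp_close cd (u := fun t => f (x, t))) => // s t scd tcd st.
apply: H => //; first by rewrite subrr normr0.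
apply: (le_lt_trans st); rewrite /mesh ltr_pdivrMr ?ltr0n //.
rewrite mulrC -ltr_pdivrMr //; apply: (lt_le_trans (truncnS_gt _)).
by rewrite ler_nat.
Qed.

(** The interpolants in the second variable are finite sums of products of
    functions of one variable, hence measurable for the product sigma-algebra,
    and they converge to f. *)
Lemma box_measurable : c < d ->
  measurable_fun (`[a, b] `*` `[c, d] : set (measurableTypeR R * measurableTypeR R)) f.
Proof using fc.
move=> cd.
pose D : set (measurableTypeR R * measurableTypeR R) := `[a, b] `*` `[c, d].
have mslice t : c <= t <= d -> measurable_fun D (fun z => f (z.1, t)).
  move=> tcd; apply: (@measurable_comp _ _ _ _ _ _ `[a, b]%classic (fun x => f (x, t))).
  - exact: measurable_itv.
  - by move=> _ [z [zX _] <-].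
  - apply: subspace_continuous_measurable_fun; first exact: measurable_itv.
    exact: box_continuous_x.
  - exact: measurable_funTS measurable_fst.
have mramp n j : measurable_fun D (fun z => ramp c d n j z.2).
  apply: (@measurableT_comp _ _ _ _ _ _ (ramp c d n j)).
    apply: measurable_maxr; first exact: measurable_cst.
    by apply: measurable_funB; [exact: measurable_id|exact: measurable_cst].
  exact: measurable_funTS measurable_snd.
apply: (@measurable_fun_cvg _ _ _ D
   (fun n z => interp c d n (fun t => f (z.1, t)) z.2)).
  move=> n; have ncd j := @node_in R c d n cd j.
  apply: measurable_funD; first by apply: mslice; rewrite lexx ltW.
  rewrite (_ : (fun z => _) = (fun z => \sum_(j <- enum 'I_n.+1)
     (f (z.1, node c d n j.+1) - f (z.1, node c d n j)) / mesh c d n *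
      (ramp c d n j z.2 - ramp c d n j.+1 z.2))); last first.
    by apply/funext => z; rewrite big_enum.
  apply: measurable_sum => j.
  apply: measurable_funM; last by apply: measurable_funB.
  apply: measurable_funM; last exact: measurable_cst.
  by apply: measurable_funB; apply: mslice; apply: ncd; rewrite // ltnW.
move=> [x y] [/=]; rewrite !in_itv /= => xab ycd; apply/cvgrPdist_le => eta eta0.
have [n0 H] := interp_unif_close cd eta0.
by exists n0 => // n /= nn; rewrite distrC; apply: H.
Qed.

End Compactness.

(** * Integrals over a box *)

Section BoxIntegral.
Context {R : realType}.
Local Notation mu := (@lebesgue_measure R).
Variables (a b c d : R).
Local Notation box := (`[a, b]%classic `*` `[c, d]%classic :
  set (measurableTypeR R * measurableTypeR R)).

Lemma measurable_box : measurable box.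
Proof. by apply: measurableX; exact: measurable_itv. Qed.

Lemma box_integrable (g : R * R -> R) (M : R) :
  measurable_fun box g -> (forall z, box z -> `|g z| <= M) ->
  (mu \x mu)%E.-integrable box (EFin \o g).
Proof.
move=> mg gM; apply: measurable_bounded_integrable => //.
- exact: measurable_box.
- have mX e1 e2 : measurable (`[e1, e2]%classic : set (measurableTypeR R)).
    exact: measurable_itv.
  have E := product_measure1E mu mu (mX a b) (mX c d).
  rewrite [X in (X < _)%E]E.
  have fin e1 e2 : (mu `[e1, e2]%classic < +oo)%E.
    by rewrite lebesgue_measure_itv /=; case: ifP => // _; rewrite -EFinB ltry.
  apply: lte_mul_pinfty; [exact: measure_ge0| |exact: fin].
  apply/fin_real/andP; split; last exact: fin.
  exact: lt_le_trans (ltNyr 0) (measure_ge0 _ _).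
- exists M; split; first exact: num_real.
  by move=> N MN z zD; apply: le_trans (gM z zD) _; exact: ltW.
Qed.

Lemma measurable_tensor (u v : R -> R) D :
  measurable_fun setT u -> measurable_fun setT v ->
  measurable_fun (D : set (measurableTypeR R * measurableTypeR R))
    (fun z => u z.1 * v z.2).
Proof.
move=> mu_u mv; apply: measurable_funM.
- apply: (@measurableT_comp _ _ _ _ _ _ u) => //.
  exact: measurable_funTS measurable_fst.
- apply: (@measurableT_comp _ _ _ _ _ _ v) => //.
  exact: measurable_funTS measurable_snd.
Qed.

Lemma integral_tensor (u v : R -> R) (p q : R) :
  measurable_fun setT u -> measurable_fun setT v ->
  (forall x, 0 <= u x) -> (forall y, 0 <= v y) ->
  (\int[mu]_(x in `[a, b]) (u x)%:E = p%:E)%E ->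
  (\int[mu]_(y in `[c, d]) (v y)%:E = q%:E)%E ->
  \int[(mu \x mu)%E]_(z in box) (u z.1 * v z.2) = p * q.
Proof.
move=> mu_u mv u0 v0 up vq.
rewrite /Rintegral integral_mkcond.
pose u' := u \_ `[a, b]%classic; pose v' := v \_ `[c, d]%classic.
have mu' : measurable_fun setT u'.
  by apply/(measurable_restrictT _ _).1 => //; exact: measurable_funTS.
have mv' : measurable_fun setT v'.
  by apply/(measurable_restrictT _ _).1 => //; exact: measurable_funTS.
have u'0 x : 0 <= u' x by rewrite /u' patchE; case: ifP.
have v'0 x : 0 <= v' x by rewrite /v' patchE; case: ifP.
rewrite (_ : _ \_ _ = fun z => (u' z.1 * v' z.2)%:E); last first.
  apply/funext => -[x y]; rewrite /u' /v' !patchE /= in_setX /=.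
  by case: ifP => /andP; case: ifP => //=; case: ifP => //=; rewrite ?mul0r ?mulr0 // => _ _ [].
rewrite fubini_tonelli1; last 2 first.
- by apply/measurable_EFinP; apply: measurable_tensor.
- by move=> z; rewrite lee_fin mulr_ge0.
have iv : (\int[mu]_y (v' y)%:E = q%:E)%E.
  rewrite -vq [RHS]integral_mkcond; apply: eq_integral => y _.
  by rewrite /v' restrict_EFin.
have iu : (\int[mu]_y (u' y)%:E = p%:E)%E.
  rewrite -up [RHS]integral_mkcond; apply: eq_integral => y _.
  by rewrite /u' restrict_EFin.
rewrite /fubini_F /=.
under eq_integral => x _.
  under eq_integral do rewrite EFinM.
  rewrite ge0_integralZl_EFin //; [|by move=> y _; rewrite lee_fin|exact/measurable_EFinP].
  rewrite iv; over.
rewrite ge0_integralZr //; [|exact/measurable_EFinP|by move=> x _; rewrite lee_fin|].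
  by rewrite iu.
by rewrite -iv; apply: integral_ge0 => y _; rewrite lee_fin.
Qed.

End BoxIntegral.

(** * Jensen gaps *)

Definition jensen_gap (R : realType) (t : R) (u : R -> R) (p q : R) : R :=
  t * u p + (1 - t) * u q - u (t * p + (1 - t) * q).

(** The gap as a signed three-point measure; this form turns iterated gaps into
    double sums over 'I_3. *)
Definition gap_weight (R : realType) (t : R) (i : 'I_3) : R :=
  nth 0 [:: t; 1 - t; -1] i.
Definition gap_point (R : realType) (t p q : R) (i : 'I_3) : R :=
  nth 0 [:: p; q; t * p + (1 - t) * q] i.

Section Gap.
Context {R : realType}.
Implicit Types (t p q : R) (u : R -> R).

Lemma jensen_gapE t u p q :
  jensen_gap t u p q = \sum_(i < 3) gap_weight t i * u (gap_point t p q i).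
Proof. by rewrite !big_ord_recl big_ord0 /jensen_gap /gap_weight /gap_point /=; ring. Qed.

Lemma jensen_gapC t u p q : jensen_gap (1 - t) u q p = jensen_gap t u p q.
Proof.
rewrite /jensen_gap (_ : _ + (1 - (1 - t)) * p = t * p + (1 - t) * q); ring.
Qed.

Lemma jensen_gap_diag t u p : jensen_gap t u p p = 0.
Proof. by rewrite /jensen_gap (_ : t * p + _ = p); ring. Qed.

Lemma gap_weight_norm t : 0 <= t <= 1 -> \sum_(i < 3) `|gap_weight t i| = 2.
Proof.
move=> /andP[t0 t1]; rewrite !big_ord_recl big_ord0 /gap_weight /=.
by rewrite normrN1 !ger0_norm ?subr_ge0 //; ring.
Qed.

Lemma gap_point_in t p q (a b : R) i : 0 <= t <= 1 -> a <= p <= b -> a <= q <= b ->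
  a <= gap_point t p q i <= b.
Proof.
move=> /andP[t0 t1] /andP[ap pb] /andP[aq qb].
case: i => -[|[|[|//]]] i3; rewrite /gap_point /=; apply/andP; split => //; nra.
Qed.

Lemma jensen_gap_is_derive t p q u u' :
  (forall x : R, is_derive x (1 : R) u (u' x)) ->
  forall x : R, is_derive x (1 : R) (fun x => jensen_gap t (fun s => u (x - s)) p q)
                  (jensen_gap t (fun s => u' (x - s)) p q).
Proof.
move=> du x.
have dshift s : is_derive x (1 : R) (fun x => u (x - s)) (u' (x - s)).
  rewrite (_ : (fun x => u (x - s)) = (fun x => u (1 * x + - s))); last first.
    by apply/funext => y; rewrite mul1r.
  rewrite -[u' _]mul1r; apply: is_derive_comp_affine; rewrite mul1r; exact: du.
have H (s c : R) : is_derive x (1 : R) (fun x => c * u (x - s)) (c * u' (x - s)).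
  by apply: (is_deriveZ c (dshift s)).
by apply: (is_deriveB (is_deriveD (H p t) (H q (1 - t))) (dshift _)).
Qed.

Lemma diff_times_jensen_gap t p q u k :
  diff_times k u -> diff_times k (fun x => jensen_gap t (fun s => u (x - s)) p q).
Proof.
move=> Du; under eq_fun do rewrite jensen_gapE.
apply: diff_times_sum => i; apply: diff_timesZ.
under eq_fun do rewrite -[X in X - _]mul1r.
exact: diff_times_comp_affine.
Qed.

(** With z the convex combination, the gap equals t (1 - t) (q - p) times the
    difference of the mean slopes on [z, q] and on [p, z], which the mean value
    theorem writes as values of the derivative at ordered points. *)
Lemma nondecreasing_derive_gap u u' :
  (forall x : R, is_derive x (1 : R) u (u' x)) -> {homo u' : x y / x <= y} ->
  forall t p q, 0 <= t <= 1 -> 0 <= jensen_gap t u p q.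
Proof.
move=> du u'mono t p q t01.
wlog pq : t p q t01 / p < q.
  move=> H; have [pq|qp|->] := ltgtP p q; first exact: H.
  - rewrite -jensen_gapC; apply: H => //.
    by case/andP: t01 => t0 t1; apply/andP; split; lra.
  - by rewrite jensen_gap_diag.
move: t01; rewrite le_eqVlt => /andP[/predU1P[<-|t0]].
  by move=> _; rewrite /jensen_gap !mul0r !add0r subr0 !mul1r subrr.
rewrite le_eqVlt => /predU1P[->|t1].
  by rewrite /jensen_gap subrr !mul0r !addr0 !mul1r subrr.
rewrite /jensen_gap; set z := t * p + (1 - t) * q.
have pz : p < z by rewrite /z; nra.
have zq : z < q by rewrite /z; nra.
have [x1] := MVT pz (fun x _ => du x) (is_derive_within_continuous du).
rewrite in_itv /= => /andP[_ x1z] E1.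
have [x2] := MVT zq (fun x _ => du x) (is_derive_within_continuous du).
rewrite in_itv /= => /andP[zx2 _] E2.
have m12 : u' x1 <= u' x2 by apply: u'mono; rewrite ltW // (lt_trans x1z).
rewrite (_ : _ - u z = (1 - t) * (u q - u z) - t * (u z - u p)); last by ring.
rewrite E1 E2 (_ : _ - _ = t * (1 - t) * (q - p) * (u' x2 - u' x1)); last first.
  by rewrite /z; ring.
by rewrite !mulr_ge0 ?subr_ge0 // ltW.
Qed.

End Gap.

(** * Second differences of mollifiers *)

Section Peak.
Context {R : realType}.
Variables (e : R) (P : mollifier e) (t p q : R).
Hypothesis t01 : 0 <= t <= 1.
Local Notation mu := (@lebesgue_measure R).

Lemma mol2_gap_ge0 x : 0 <= jensen_gap t (fun s => mol2 P (x - s)) p q.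
Proof using t01.
have mono : {homo mol1 P : x y / x <= y}.
  move=> y z; rewrite le_eqVlt => /predU1P[->//|yz].
  have [w _] := MVT yz (fun x _ => mol1_is_derive P x)
    (is_derive_within_continuous (mol1_is_derive P)).
  by rewrite -subr_ge0 => ->; rewrite mulr_ge0 ?mol0_ge0 // subr_ge0 ltW.
have := nondecreasing_derive_gap (mol2_is_derive P) mono (x - p) (x - q) t01.
rewrite /jensen_gap; congr (_ <= _ - mol2 P _); ring.
Qed.

Lemma mol2_affine y : e <= y -> mol2 P y = mol2 P e + mol_mass P * (y - e).
Proof.
rewrite le_eqVlt => /predU1P[<-|ey]; first by rewrite subrr mulr0 addr0.
have [w] := MVT ey (fun x _ => mol2_is_derive P x)
    (is_derive_within_continuous (mol2_is_derive P)).
rewrite in_itv /= => /andP[ew _]; rewrite mol1_ge ?(ltW ew) // => <-; ring.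
Qed.

(** To the left of all three points the three translates vanish; to the right
    of the three bumps they are affine with equal slopes, and a gap of an affine
    function is zero. *)
Lemma mol2_gap_support (x0 x1 x : R) : x0 <= p <= x1 -> x0 <= q <= x1 ->
  jensen_gap t (fun s => mol2 P (x - s)) p q != 0 -> x0 <= x <= x1 + e.
Proof using t01.
move=> px qx; have zx : x0 <= t * p + (1 - t) * q <= x1.
  by have := gap_point_in (Ordinal (ltnSn 2)) t01 px qx.
apply: contraR; rewrite negb_and -!ltNge => /orP[xx0|xx1]; apply/eqP;
    case/andP: px => p0 p1; case/andP: qx => q0 q1; case/andP: zx => z0 z1.
  by rewrite /jensen_gap !mol2_le0 ?subr_le0 ?mulr0 ?addr0 ?subr0 //; lra.
have A s : s <= x1 -> mol2 P (x - s) = mol2 P e + mol_mass P * (x - s - e).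
  by move=> sx; rewrite mol2_affine //; lra.
by rewrite /jensen_gap !A //; ring.
Qed.

End Peak.

Lemma mol0_integral (R : realType) (e : R) (P : mollifier e) (a b s : R) :
  a <= s -> s + e <= b -> 0 < e ->
  (\int[@lebesgue_measure R]_(x in `[a, b]) (mol0 P (x - s))%:E = (mol_mass P)%:E)%E.
Proof.
move=> as_ sb e0.
have d0 := mol1_is_derive P.
have dQ x : is_derive x (1 : R) (fun x => mol1 P (x - s)) (mol0 P (x - s)).
  rewrite (_ : (fun x => mol1 P (x - s)) = (fun x => mol1 P (1 * x + - s))); last first.
    by apply/funext => y; rewrite mul1r.
  rewrite -[mol0 P _]mul1r; apply: is_derive_comp_affine; rewrite mul1r; exact: d0.
have Qc := is_derive_continuous dQ.
have [r' dr _] := mol0_smooth P 1.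
have rc : continuous (mol0 P) := is_derive_continuous dr.
rewrite (@continuous_FTC2 _ _ (fun x => mol1 P (x - s))).
- by rewrite mol1_ge ?lerBrDl // mol1_le0 ?subr_le0 // -EFinB subr0.
- by rewrite (le_lt_trans as_) // (lt_le_trans _ sb) // ltrDl.
- apply: continuous_subspaceT => x.
  apply: (@continuous_comp _ _ _ (fun x => x - s) (mol0 P)); last exact: rc.
  by apply: cvgB; [exact: cvg_id|exact: cvg_cst].
- split.
  + by move=> x _; exact: (@ex_derive _ _ _ _ _ _ _ (dQ x)).
  + by apply: cvg_at_right_filter; exact: Qc.
  + by apply: cvg_at_left_filter; exact: Qc.
- by move=> x _; rewrite derive1E; exact: (@derive_val _ _ _ _ _ _ _ (dQ x)).
Qed.

Lemma Rintegral_lincomb (d : measure_display) (T : measurableType d) (R : realType)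
    (mu : {measure set T -> \bar R}) (D : set T) (I : Type) (r : seq I)
    (w : I -> R) (g : I -> T -> R) :
  measurable D -> (forall i, mu.-integrable D (EFin \o g i)) ->
  mu.-integrable D (EFin \o (fun z => \sum_(i <- r) w i * g i z)) /\
  \int[mu]_(z in D) (\sum_(i <- r) w i * g i z) =
  \sum_(i <- r) w i * \int[mu]_(z in D) g i z.
Proof.
move=> mD ig; elim: r => [|i r [IH1 IH2]].
  under eq_fun do rewrite big_nil.
  rewrite big_nil; split; first exact: integrable0.
  by rewrite Rintegral_cst // mul0r.
have iw : mu.-integrable D (EFin \o (fun z => w i * g i z)).
  rewrite (_ : EFin \o _ = (fun z => (w i)%:E * (EFin \o g i) z)%E) //.
  exact: integrableZl.
rewrite big_cons -IH2 -RintegralZl //.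
rewrite (_ : (fun z => \sum_(j <- i :: r) w j * g j z) =
   (fun z => w i * g i z + \sum_(j <- r) w j * g j z)); last first.
  by apply/funext => z; rewrite big_cons.
split; first by apply: (integrableD mD iw IH1).
by rewrite -RintegralD.
Qed.

(** * From the distributional inequality to mixed Jensen gaps *)

(** A contraction of [a, b] towards its midpoint, close to the identity, that
    leaves room for a bump of width e inside the open interval. Being affine, it
    maps convex combinations to convex combinations; so a gap at boundary points
    is approximated by gaps at interior points in the same step that smooths
    it. *)
Lemma interior_homothety (R : realType) (a b delta : R) : a < b -> 0 < delta ->
  exists (sh : R -> R) (e x0 x1 : R),
  [/\ [/\ 0 < e, a < x0 & x1 + e < b],
      forall t p q, sh (t * p + (1 - t) * q) = t * sh p + (1 - t) * sh q,
      forall p, a <= p <= b -> x0 <= sh p <= x1 &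
      forall p x, a <= p <= b -> sh p <= x <= sh p + e -> `|x - p| < delta].
Proof.
move=> ab d0; pose tau := Num.min 1 (delta / (b - a)).
have ba0 : 0 < b - a by rewrite subr_gt0.
have tau0 : 0 < tau by rewrite lt_min ltr01 divr_gt0.
have tau1 : tau <= 1 by rewrite ge_min lexx.
have taud : tau * (b - a) <= delta by rewrite -ler_pdivlMr // ge_min lexx orbT.
pose w := tau * (b - a).
have w0 : 0 < w by rewrite mulr_gt0.
exists (fun p => p + tau * ((a + b) / 2 - p)), (w / 4), (a + w / 2), (b - w / 2).
split.
- by split; lra.
- by move=> t p q; ring.
- move=> p /andP[ap pb].
  have h1 : 0 <= (1 - tau) * (p - a) by rewrite mulr_ge0 ?subr_ge0.
  have h2 : 0 <= (1 - tau) * (b - p) by rewrite mulr_ge0 ?subr_ge0.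
  apply/andP; split; rewrite -subr_ge0.
    by rewrite (_ : _ - _ = (1 - tau) * (p - a)) // /w; field.
  by rewrite (_ : _ - _ = (1 - tau) * (b - p)) // /w; field.
- move=> p x /andP[ap pb] /andP[xl xr].
  have h1 : 0 <= tau * (p - a) by rewrite mulr_ge0 ?subr_ge0 // ltW.
  have h2 : 0 <= tau * (b - p) by rewrite mulr_ge0 ?subr_ge0 // ltW.
  rewrite ltr_norml; apply/andP; split.
    apply: (@lt_le_trans _ _ (- (w / 2))); first by rewrite /w in w0 *; lra.
    apply: (@le_trans _ _ (tau * ((a + b) / 2 - p))); last lra.
    by rewrite -subr_ge0 (_ : _ - _ = tau * (b - p)) // /w; field.
  apply: (@le_lt_trans _ _ (w / 2 + w / 4)); last by rewrite /w in w0 *; lra.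
  apply: (@le_trans _ _ (tau * ((a + b) / 2 - p) + w / 4)); first lra.
  by rewrite lerD2r -subr_ge0 (_ : _ - _ = tau * (p - a)) // /w; field.
Qed.

Section Mol0.
Context {R : realType} (e : R) (P : mollifier e).

Lemma mol0_continuous : continuous (mol0 P).
Proof. by have [r' dr _] := mol0_smooth P 1; exact: is_derive_continuous dr. Qed.

Lemma measurable_mol0_shift (s : R) : measurable_fun setT (fun x : R => mol0 P (x - s)).
Proof.
apply: continuous_measurable_fun => x.
apply: (@continuous_comp _ _ _ (fun x : R => x - s) (mol0 P)).
  by apply: cvgB; [exact: cvg_id|exact: cvg_cst].
exact: mol0_continuous.
Qed.

Lemma mol0_bounded : exists2 M, 0 <= M & forall x, mol0 P x <= M.
Proof.
have [M M0 HM] := compact_bounded_fun (@segment_compact R 0 e)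
  (continuous_subspaceT mol0_continuous).
exists M => // x; have [x0|x0] := leP x 0; first by rewrite mol0_le0.
have [xe|ex] := leP e x; first by rewrite mol0_ge.
by rewrite (le_trans (ler_norm _)) // HM //= in_itv /= !ltW.
Qed.

End Mol0.

Section MixedGap.
Context {R : realType}.
Variables (a b c d : R) (f : R * R -> R).
Hypotheses (ab : a < b) (cd : c < d).
Hypothesis fc : {within `[a, b] `*` `[c, d], continuous f}.
Hypothesis fm : mixed_monge_ge0 `[a, b] `[c, d] f.
Local Notation mu := (@lebesgue_measure R).
Local Notation box := (`[a, b]%classic `*` `[c, d]%classic :
  set (measurableTypeR R * measurableTypeR R)).

(** Test with a product of second differences of mollifiers, located at the
    contracted points: the pairing is then minus the integral of f against a
    signed sum of nine product bumps of equal mass. On each bump f differs from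
    its value at the original point by at most eta / 4, and the absolute weights
    sum to 4, so that the mixed gap is at most eta. *)
Lemma mixed_gap_le0 (t s p q r r' : R) :
  0 <= t <= 1 -> 0 <= s <= 1 -> a <= p <= b -> a <= q <= b ->
  c <= r <= d -> c <= r' <= d ->
  jensen_gap t (fun x => jensen_gap s (fun y => f (x, y)) r r') p q <= 0.
Proof using ab cd fc fm.
move=> t01 s01 pab qab rcd r'cd; apply/ler_addgt0Pr => eta eta0; rewrite add0r.
have eta40 : 0 < eta / 4 by rewrite divr_gt0.
have [delta d0 Hd] := box_unif_continuous fc eta40.
have [shx [ex [x0 [x1 [[ex0 ax0 x1b] shxA shxI shxC]]]]] := interior_homothety ab d0.
have [shy [ey [y0 [y1 [[ey0 cy0 y1d] shyA shyI shyC]]]]] := interior_homothety cd d0.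
have [Px _] := mollifier_exists ex0.
have [Py _] := mollifier_exists ey0.
pose ux k := fun x => jensen_gap t (fun z => k (x - z)) (shx p) (shx q).
pose uy k := fun y => jensen_gap s (fun z => k (y - z)) (shy r) (shy r').
have test : nonneg_test_function (`[a, b] `*` `[c, d])
    (fun z : R * R => ux (mol2 Px) z.1 * uy (mol2 Py) z.2).
  apply: (nonneg_test_tensor ax0 x1b cy0 y1d).
  - by move=> k; apply: diff_times_jensen_gap; exact: mol2_smooth.
  - by move=> k; apply: diff_times_jensen_gap; exact: mol2_smooth.
  - by move=> x; apply: mol2_gap_ge0.
  - by move=> y; apply: mol2_gap_ge0.
  - by move=> x; apply: mol2_gap_support => //; apply: shxI.
  - by move=> y; apply: mol2_gap_support => //; apply: shyI.
have dx k k' : (forall x : R, is_derive x (1 : R) k (k' x)) ->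
    forall x : R, is_derive x (1 : R) (ux k) (ux k' x).
  by move=> dk; exact: jensen_gap_is_derive.
have dy k k' : (forall x : R, is_derive x (1 : R) k (k' x)) ->
    forall x : R, is_derive x (1 : R) (uy k) (uy k' x).
  by move=> dk; exact: jensen_gap_is_derive.
have Psi := mixed_partial_tensor (dx _ _ (mol2_is_derive Px))
  (dx _ _ (mol1_is_derive Px)) (dy _ _ (mol2_is_derive Py)) (dy _ _ (mol1_is_derive Py)).
have := fm test; rewrite /mixed_pairing Psi {Psi test}.
rewrite oppr_ge0 => Ile0.
pose wt (k : 'I_3 * 'I_3) := gap_weight t k.1 * gap_weight s k.2.
pose px i := gap_point t p q i; pose py j := gap_point s r r' j.
pose g (k : 'I_3 * 'I_3) (z : R * R) :=
  mol0 Px (z.1 - shx (px k.1)) * mol0 Py (z.2 - shy (py k.2)).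
(* Coefficients of a minorant of the integrand: f is frozen at the nine points,
   at the cost of the oscillation eta / 4 times the absolute weight. *)
pose cf (k : 'I_3 * 'I_3) := wt k * f (px k.1, py k.2) - `|wt k| * (eta / 4).
have pxI i : a <= px i <= b by apply: gap_point_in.
have pyI j : c <= py j <= d by apply: gap_point_in.
have double (F : 'I_3 -> 'I_3 -> R) :
    \sum_(i < 3) \sum_(j < 3) F i j = \sum_(k <- index_enum ('I_3 * 'I_3)%type) F k.1 k.2.
  by rewrite pair_big.
have shxP i : gap_point t (shx p) (shx q) i = shx (px i).
  by rewrite /px /gap_point; case: i => -[|[|[|//]]] ? //=; rewrite shxA.
have shyP j : gap_point s (shy r) (shy r') j = shy (py j).
  by rewrite /py /gap_point; case: j => -[|[|[|//]]] ? //=; rewrite shyA.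
have PsiE z : ux (mol0 Px) z.1 * uy (mol0 Py) z.2 =
    \sum_(k <- index_enum ('I_3 * 'I_3)%type) wt k * g k z.
  rewrite /ux /uy !jensen_gapE big_distrl /=.
  under eq_bigr do rewrite big_distrr /=.
  rewrite double; apply: eq_bigr => k _.
  by rewrite shxP shyP /wt /g; ring.
have mg k : measurable_fun box (g k).
  rewrite /g; apply: (measurable_tensor (u := fun x => mol0 Px (x - shx (px k.1)))
    (v := fun y => mol0 Py (y - shy (py k.2)))).
    exact: measurable_mol0_shift.
  exact: measurable_mol0_shift.
have g_int k : \int[(mu \x mu)%E]_(z in box) g k z = mol_mass Px * mol_mass Py.
  have /andP[x0k xk1] := shxI _ (pxI k.1); have /andP[y0k yk1] := shyI _ (pyI k.2).
  apply: (integral_tensor (u := fun x => mol0 Px (x - shx (px k.1)))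
    (v := fun y => mol0 Py (y - shy (py k.2)))).
  - exact: measurable_mol0_shift.
  - exact: measurable_mol0_shift.
  - by move=> x; exact: mol0_ge0.
  - by move=> y; exact: mol0_ge0.
  - apply: mol0_integral => //; first exact: ltW (lt_le_trans ax0 x0k).
    by apply: le_trans (ltW x1b); rewrite lerD2r.
  - apply: mol0_integral => //; first exact: ltW (lt_le_trans cy0 y0k).
    by apply: le_trans (ltW y1d); rewrite lerD2r.
have [Mx Mx0 HMx] := mol0_bounded Px; have [My My0 HMy] := mol0_bounded Py.
have g0 k z : 0 <= g k z by rewrite mulr_ge0 ?mol0_ge0.
have gM k z : g k z <= Mx * My by apply: ler_pM; rewrite ?mol0_ge0.
have gi k : (mu \x mu)%E.-integrable box (EFin \o g k).
  by apply: (box_integrable (M := Mx * My) (mg k)) => z _; rewrite ger0_norm.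
have [Mf Mf0 HMf] := box_bounded fc.
have fgi k : (mu \x mu)%E.-integrable box (EFin \o (fun z => f z * g k z)).
  apply: (box_integrable (M := Mf * (Mx * My))).
    by apply: measurable_funM (mg k); exact: box_measurable.
  move=> [x y] [/=]; rewrite !in_itv /= => xab ycd.
  by rewrite normrM ler_pM // ?HMf // ger0_norm.
have fi : (mu \x mu)%E.-integrable box
    (EFin \o (fun z => f z * (ux (mol0 Px) z.1 * uy (mol0 Py) z.2))).
  have [H _] := Rintegral_lincomb (index_enum ('I_3 * 'I_3)%type) wt
    (measurable_box a b c d) fgi.
  have -> : (fun z => f z * (ux (mol0 Px) z.1 * uy (mol0 Py) z.2)) =
      (fun z => \sum_(k <- index_enum ('I_3 * 'I_3)%type) wt k * (f z * g k z)).
    apply/funext => z; rewrite PsiE big_distrr /=; apply: eq_bigr => k _.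
    by rewrite mulrCA.
  exact: H.
have [Li LE] := Rintegral_lincomb (index_enum ('I_3 * 'I_3)%type) cf (measurable_box a b c d) gi.
have Lle z : box z -> \sum_(k <- index_enum ('I_3 * 'I_3)%type) cf k * g k z <=
    f z * (ux (mol0 Px) z.1 * uy (mol0 Py) z.2).
  case: z => x y [/=]; rewrite !in_itv /= => xab ycd.
  have /= -> := PsiE (x, y); rewrite big_distrr /=; apply: ler_sum => k _.
  have [->|gn0] := eqVneq (g k (x, y)) 0; first by rewrite !mulr0.
  have [xk yk] : shx (px k.1) <= x <= shx (px k.1) + ex /\
      shy (py k.2) <= y <= shy (py k.2) + ey.
    move: gn0; rewrite /g /= mulf_eq0 negb_or => /andP[gx gy]; split.
      apply: contraR gx; rewrite negb_and -!ltNge => /orP[xx|xx].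
        by rewrite mol0_le0 // subr_le0 ltW.
      by rewrite mol0_ge // lerBrDl ltW.
    apply: contraR gy; rewrite negb_and -!ltNge => /orP[yy|yy].
      by rewrite mol0_le0 // subr_le0 ltW.
    by rewrite mol0_ge // lerBrDl ltW.
  have close := Hd x (px k.1) y (py k.2) xab (pxI _) ycd (pyI _)
    (shxC _ _ (pxI _) xk) (shyC _ _ (pyI _) yk).
  rewrite mulrA [f _ * _]mulrC; apply: ler_wpM2r => //.
  rewrite /cf lerBlDr -lerBlDl -mulrBr.
  by rewrite (le_trans (ler_norm _)) // normrM ler_wpM2l // distrC.
have := le_Rintegral (measurable_box a b c d) Li fi Lle.
move=> /le_trans/(_ Ile0); rewrite LE.
under eq_bigr do rewrite g_int.
rewrite -big_distrl /= pmulr_lle0; last by rewrite mulr_gt0 ?mol_mass_gt0.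
rewrite /cf sumrB subr_le0 -big_distrl /=.
have -> : \sum_(k <- index_enum ('I_3 * 'I_3)%type) `|wt k| = 4.
  rewrite (eq_bigr (fun k => `|gap_weight t k.1| * `|gap_weight s k.2|)); last first.
    by move=> k _; rewrite normrM.
  rewrite -(double (fun i j => `|gap_weight t i| * `|gap_weight s j|)).
  under eq_bigr do rewrite -big_distrr /= gap_weight_norm //.
  by rewrite -big_distrl /= gap_weight_norm // -natrM.
rewrite mulrC divfK ?pnatr_eq0 //; congr (_ <= _).
rewrite jensen_gapE.
under [RHS]eq_bigr do rewrite jensen_gapE big_distrr /=.
by rewrite double; apply: eq_bigr => k _; rewrite mulrA.
Qed.

End MixedGap.

(** * Calculus of convex functions on a set *)

Section ConvexOn.
Context {R : realType}.
Implicit Types (D : set R) (t p q : R) (u v : R -> R).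

Lemma convex_onP D u : convex_on D u <->
  forall t p q, 0 <= t <= 1 -> D p -> D q -> 0 <= jensen_gap t u p q.
Proof.
split=> [cu t p q /andP[t0 t1] Dp Dq|cu t p q /set_mem Dp /set_mem Dq].
  have := cu (Itv01 t0 t1) p q (mem_set Dp) (mem_set Dq).
  by rewrite /jensen_gap subr_ge0.
by have := cu t%:num p q _ Dp Dq; rewrite /jensen_gap subr_ge0; apply; rewrite ge0 le1.
Qed.

Lemma jensen_gapD t u v p q :
  jensen_gap t (fun x => u x + v x) p q = jensen_gap t u p q + jensen_gap t v p q.
Proof. by rewrite /jensen_gap; ring. Qed.

Lemma jensen_gapZ t (k : R) u p q :
  jensen_gap t (fun x => k * u x) p q = k * jensen_gap t u p q.
Proof. by rewrite /jensen_gap; ring. Qed.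

Lemma jensen_gapN t u p q :
  jensen_gap t (fun x => - u x) p q = - jensen_gap t u p q.
Proof. by rewrite /jensen_gap; ring. Qed.

Lemma jensen_gap_affine t (k l : R) p q : jensen_gap t (fun x => k * x + l) p q = 0.
Proof. by rewrite /jensen_gap; ring. Qed.

Lemma jensen_gap_swap t s (w : R -> R -> R) p q r r' :
  jensen_gap t (fun x => jensen_gap s (w x) r r') p q =
  jensen_gap s (fun y => jensen_gap t (w^~ y) p q) r r'.
Proof. by rewrite /jensen_gap; ring. Qed.

Lemma convex_on_affine D (k l : R) : convex_on D (fun x => k * x + l).
Proof. by apply/convex_onP => t p q _ _ _; rewrite jensen_gap_affine. Qed.

Lemma convex_on_cst D (k : R) : convex_on D (fun _ => k).
Proof.
have -> : (fun _ : R => k) = (fun x => 0 * x + k).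
  by apply/funext => x; rewrite mul0r add0r.
exact: convex_on_affine.
Qed.

Lemma convex_onD D u v :
  convex_on D u -> convex_on D v -> convex_on D (fun x => u x + v x).
Proof.
move=> /convex_onP cu /convex_onP cv; apply/convex_onP => t p q t01 Dp Dq.
by rewrite jensen_gapD addr_ge0 ?cu ?cv.
Qed.

Lemma concave_onN D u : convex_on D u -> concave_on D (fun x => - u x).
Proof. by rewrite /concave_on; under [in X in _ -> X]eq_fun do rewrite opprK. Qed.

Lemma convex_onS D D' u : D `<=` D' -> convex_on D' u -> convex_on D u.
Proof. by move=> DD /convex_onP cu; apply/convex_onP => t p q *; apply: cu => //; apply: DD. Qed.

Lemma within_continuousD D u v : {within D, continuous u} ->
  {within D, continuous v} -> {within D, continuous (fun x => u x + v x)}.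
Proof. by move=> cu cv x; apply: continuousD; [exact: cu|exact: cv]. Qed.

Lemma within_continuousZ D (k : R) u : {within D, continuous u} ->
  {within D, continuous (fun x => k * u x)}.
Proof. by move=> cu x; apply: continuousM; [exact: cst_continuous|exact: cu]. Qed.

Lemma within_continuousN D u : {within D, continuous u} ->
  {within D, continuous (fun x => - u x)}.
Proof. by move=> cu x; apply: continuousN; exact: cu. Qed.

Lemma within_continuous_affine D (k l : R) : {within D, continuous (fun x => k * x + l)}.
Proof.
apply: continuous_subspaceT => x; apply: cvgD; last exact: cvg_cst.
by apply: cvgM; [exact: cvg_cst|exact: cvg_id].
Qed.

Lemma within_continuous_cst D (k : R) : {within D, continuous (fun _ : R => k)}.
Proof. by apply: continuous_subspaceT => x; exact: cvg_cst. Qed.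

End ConvexOn.

(** * Convexity properties of the interpolation formula *)

Section GreenConcave.
Context {R : realType}.
Variables (c d : R) (n : nat).

Lemma ramp_convex j D : convex_on D (ramp c d n j).
Proof.
apply/convex_onP => t p q /andP[t0 t1] _ _; rewrite /jensen_gap subr_ge0 /ramp ge_max.
set z := node _ _ _ _.
have hp : 0 <= Num.max 0 (p - z) /\ p - z <= Num.max 0 (p - z).
  by rewrite !le_max !lexx orbT.
have hq : 0 <= Num.max 0 (q - z) /\ q - z <= Num.max 0 (q - z).
  by rewrite !le_max !lexx orbT.
move: hp hq; move: (Num.max _ _) (Num.max _ _) => A B [A0 Ap] [B0 Bq].
have t1' : 0 <= 1 - t by rewrite subr_ge0.
rewrite addr_ge0 ?mulr_ge0 //=.
apply: (@le_trans _ _ (t * (p - z) + (1 - t) * (q - z))).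
  by rewrite le_eqVlt; apply/orP; left; apply/eqP; ring.
by rewrite lerD // ler_wpM2l.
Qed.

Lemma green_concave j D : concave_on D (green c d n j).
Proof.
rewrite /concave_on (_ : (fun t => _) = (fun y => ramp c d n j.+1 y +
   ((- ((d - node c d n j.+1) / (d - c))) * y + c * ((d - node c d n j.+1) / (d - c))))).
  by apply: convex_onD; [exact: ramp_convex|exact: convex_on_affine].
by apply/funext => y; rewrite /green; ring.
Qed.

Lemma green_continuous j D : {within D, continuous (green c d n j)}.
Proof.
rewrite (_ : green c d n j = (fun y => - ramp c d n j.+1 y +
   ((((d - node c d n j.+1) / (d - c))) * y - c * ((d - node c d n j.+1) / (d - c))))).
  apply: within_continuousD; last exact: within_continuous_affine.
  apply: within_continuousN; apply: continuous_subspaceT => x.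
  apply: (@continuous_max R R (fun=> 0) (fun y => y - node c d n j.+1)).
    exact: cvg_cst.
  by apply: cvgB; [exact: cvg_id|exact: cvg_cst].
by apply/funext => y; rewrite /green; ring.
Qed.

(** The coefficients of the interpolation formula are midpoint gaps; this links
    them to concavity in y and to the mixed gaps. *)
Lemma concavityE (u : R -> R) j :
  concavity c d n u j = - (2 / mesh c d n) *
    jensen_gap 2^-1 u (node c d n j) (node c d n j.+2).
Proof.
rewrite /concavity /jensen_gap !nodeS.
rewrite (_ : 2^-1 * node c d n j + _ = node c d n j + mesh c d n); last by field.
by move: (mesh c d n)^-1 => m; field.
Qed.

End GreenConcave.

(** * Change of sign in the distributional inequality *)

(** Exchanging the integrals of the positive and the
    negative part changes the sign of their difference, and if the difference is
    infinite then its real part is zero on both sides. *)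
Lemma RintegralN_total (d : measure_display) (T : measurableType d) (R : realType)
    (mu : {measure set T -> \bar R}) (D : set T) (g : T -> R) :
  \int[mu]_(x in D) (- g x) = - \int[mu]_(x in D) g x.
Proof.
rewrite /Rintegral [in LHS]integralE [in RHS]integralE.
rewrite (_ : (fun x => (- g x)%:E) = (\- (EFin \o g))%E) //.
rewrite funeposN funenegN.
by case: (\int[mu]_(x in D) _)%E => [A| |]; case: (\int[mu]_(x in D) _)%E => [B| |] //=;
  rewrite ?oppr0 // opprB.
Qed.

Lemma mixed_pairingN (R : realType) (X Y : set R) (f phi : R * R -> R) :
  mixed_pairing X Y (fun z => - f z) phi = - mixed_pairing X Y f phi.
Proof.
rewrite /mixed_pairing; congr (- _); rewrite -RintegralN_total.
by apply: eq_Rintegral => z _; rewrite mulNr.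
Qed.

Lemma mixed_monge_le0N (R : realType) (X Y : set R) (f : R * R -> R) :
  mixed_monge_le0 X Y f -> mixed_monge_ge0 X Y (fun z => - f z).
Proof. by move=> fm phi tphi; rewrite mixed_pairingN oppr_ge0; exact: fm. Qed.

(** * Expansion into products of convex and concave functions *)

Section Expansion.
Context {R : realType}.
Variables (a b c d : R) (f : R * R -> R).
Hypotheses (ab : a <= b) (cd : c <= d).
Hypothesis fc : {within `[a, b] `*` `[c, d], continuous f}.
Hypothesis fcv : forall y, `[c, d]%classic y -> convex_on `[a, b] (fun x => f (x, y)).
Hypothesis fcc : forall x, `[a, b]%classic x -> concave_on `[c, d] (fun y => f (x, y)).
Hypothesis fmix : forall t s p q r r', 0 <= t <= 1 -> 0 <= s <= 1 ->
  a <= p <= b -> a <= q <= b -> c <= r <= d -> c <= r' <= d ->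
  jensen_gap t (fun x => jensen_gap s (fun y => f (x, y)) r r') p q <= 0.

Lemma concavity_ge0 n j x : c < d -> (j < n)%N -> a <= x <= b ->
  0 <= concavity c d n (fun y => f (x, y)) j.
Proof using fcc.
move=> cd' jn xab; rewrite concavityE mulNr -mulrN -jensen_gapN.
apply: mulr_ge0; first by rewrite divr_ge0 // ltW // mesh_gt0.
have /convex_onP H := fcc (x := x) xab.
have j0 : (j <= n.+1)%N by rewrite ltnW // ltnW.
by apply: H; rewrite /= ?in_itv /= ?node_in //; lra.
Qed.

Lemma concavity_convex n j : c < d -> (j < n)%N ->
  convex_on `[a, b] (fun x => concavity c d n (fun y => f (x, y)) j).
Proof using fmix.
move=> cd' jn; apply/convex_onP => t p q t01; rewrite /= !in_itv /= => pab qab.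
have j0 : (j <= n.+1)%N by rewrite ltnW // ltnW.
rewrite (_ : (fun x => _) = (fun x => - (2 / mesh c d n) *
    jensen_gap 2^-1 (fun y => f (x, y)) (node c d n j) (node c d n j.+2))); last first.
  by apply/funext => x; rewrite concavityE.
rewrite jensen_gapZ mulNr -mulrN; apply: mulr_ge0.
  by rewrite divr_ge0 // ltW // mesh_gt0.
rewrite oppr_ge0.
by apply: fmix => //; rewrite ?node_in //; lra.
Qed.

Lemma concavity_continuous n j : c < d -> (j < n)%N ->
  {within `[a, b], continuous (fun x => concavity c d n (fun y => f (x, y)) j)}.
Proof using fc.
move=> cd' jn.
have slice i : (i <= n.+1)%N -> {within `[a, b], continuous (fun x => f (x, node c d n i))}.
  by move=> i_n; apply: (box_continuous_x fc); exact: node_in.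
rewrite (_ : (fun x => _) = (fun x => (mesh c d n)^-1 *
    ((2 * f (x, node c d n j.+1) + - f (x, node c d n j)) + - f (x, node c d n j.+2)))).
  have j0 : (j <= n.+1)%N by rewrite ltnW // ltnW.
  apply: within_continuousZ; apply: within_continuousD; last first.
    by apply: within_continuousN; exact: slice.
  apply: within_continuousD; last by apply: within_continuousN; exact: slice.
  by apply: within_continuousZ; apply: slice; exact: ltnW.
by apply/funext => x; rewrite /concavity mulrC.
Qed.

(** The interpolation formula in y. The nodal concavities are nonnegative because
    f is concave in y, and convex in x because the mixed gaps are nonpositive;
    they multiply Green kernels, which are nonnegative and concave. The boundary
    values f (., c) and f (., d) multiply nonnegative affine functions of y with
    sum 1, so that a constant M can be added to make them nonnegative and then
    subtracted globally. *)
Lemma saddle_expansion (eps : R) : 0 < eps ->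
  exists (n : nat) (e k : 'I_n.+1 -> R -> R) (M : R),
  [/\ forall i, [/\ convex_on `[a, b] (e i), {within `[a, b], continuous (e i)} &
                    forall x, a <= x <= b -> 0 <= e i x],
      forall i, [/\ concave_on `[c, d] (k i), {within `[c, d], continuous (k i)} &
                    forall y, c <= y <= d -> 0 <= k i y] &
      forall x y, a <= x <= b -> c <= y <= d ->
        `|f (x, y) - (\sum_i e i x * k i y - M)| <= eps].
Proof using ab cd fc fcv fcc fmix.
move=> eps0.
have [M M0 HM] := box_bounded fc.
have shift y : c <= y <= d -> [/\ convex_on `[a, b] (fun x => f (x, y) + M),
    {within `[a, b], continuous (fun x => f (x, y) + M)} &
    forall x, a <= x <= b -> 0 <= f (x, y) + M].
  move=> ycd; split.
  - by apply: convex_onD; [exact: fcv|exact: convex_on_cst].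
  - by apply: within_continuousD; [exact: (box_continuous_x fc)|exact: within_continuous_cst].
  - by move=> x xab; have := HM x y xab ycd; rewrite ler_norml => /andP[]; lra.
have affine (l m : R) : (forall y, c <= y <= d -> 0 <= l * y + m) ->
    [/\ concave_on `[c, d] (fun y => l * y + m),
        {within `[c, d], continuous (fun y => l * y + m)} &
        forall y, c <= y <= d -> 0 <= l * y + m].
  move=> lm0; split=> //; last exact: within_continuous_affine.
  rewrite /concave_on (_ : (fun y => _) = (fun y => (- l) * y + (- m))).
    exact: convex_on_affine.
  by apply/funext => y; ring.
have ccd : c <= c <= d by rewrite lexx.
have dcd : c <= d <= d by rewrite lexx andbT.
have [cdE|] := eqVneq c d.
  exists 0%N, (fun _ x => f (x, c) + M), (fun _ y => 0 * y + 1), M; split.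
  - by move=> _; exact: shift.
  - by move=> _; apply: affine => y _; rewrite mul0r add0r.
  - move=> x y xab; rewrite -cdE => ycc; have -> : y = c by lra.
    by rewrite big_ord1 mul0r add0r mulr1 addrK subrr normr0 ltW.
move=> cdN; have cd' : c < d by rewrite lt_neqAle cdN.
have [n Hn] := interp_unif_close fc cd' eps0.
pose E j x := match j with
  | 0%N => f (x, c) + M
  | 1%N => f (x, d) + M
  | j'.+2 => concavity c d n (fun y => f (x, y)) j' end.
pose K j y := match j with
  | 0%N => (- (d - c)^-1) * y + d / (d - c)
  | 1%N => (d - c)^-1 * y + (- c / (d - c))
  | j'.+2 => green c d n j' y end.
have dc0 : 0 < d - c by rewrite subr_gt0.
exists n.+1, (fun i => E i), (fun i => K i), M; split.
- case=> -[|[|j]] /= jn; [exact: shift|exact: shift|].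
  split; [exact: concavity_convex|exact: concavity_continuous|].
  by move=> x; exact: concavity_ge0.
- case=> -[|[|j]] /= jn.
  + apply: affine => y /andP[cy yd].
    have -> : - (d - c)^-1 * y + d / (d - c) = (d - y) / (d - c) by ring.
    by rewrite divr_ge0 ?subr_ge0.
  + apply: affine => y /andP[cy yd].
    have -> : (d - c)^-1 * y + - c / (d - c) = (y - c) / (d - c) by ring.
    by rewrite divr_ge0 ?subr_ge0.
  + split; [exact: green_concave|exact: green_continuous|].
    by move=> y; exact: green_ge0.
- move=> x y xab ycd; have := Hn n (leqnn n) x y xab ycd.
  rewrite distrC; congr (`|_ - _| <= _); rewrite interp_green //.
  rewrite !big_ord_recl /=; move: (\sum_(j < n) _ * green c d n j y) => S.
  by field; rewrite gt_eqF.
Qed.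

End Expansion.

(** * Approximation of saddle data by a universal approximator *)

Section Approximation.
Context {R : realType}.

Lemma sup_norm_lt_pointwise (T : Type) (D : set T) (u : T -> R) (delta : R) :
  (sup_norm_on D u < delta%:E)%E -> forall z, D z -> `|u z| < delta.
Proof.
move=> ud z Dz; rewrite -lte_fin; apply: le_lt_trans ud.
by apply: ereal_sup_ubound; exists z.
Qed.

Lemma sup_norm_lt (T : Type) (D : set T) (u : T -> R) (delta eps : R) :
  delta < eps -> (forall z, D z -> `|u z| <= delta) -> (sup_norm_on D u < eps%:E)%E.
Proof.
move=> de H; apply: (@le_lt_trans _ _ delta%:E); last by rewrite lte_fin.
by apply: ge_ereal_sup => _ [z Dz <-]; rewrite lee_fin; exact: H.
Qed.

Variable C : set (R -> R).
Hypothesis Ccvx : forall phi, C phi -> convex_on setT phi.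
Hypothesis Cuniv : universal_approximator C.

(** One-sided approximation keeps signs: approximating from above preserves
    nonnegativity, from below nonpositivity. It is obtained by approximating a
    vertical shift of u. *)
Lemma class_approx_above (a b : R) (u : R -> R) (delta : R) : a <= b ->
  convex_on `[a, b] u -> {within `[a, b], continuous u} -> 0 < delta ->
  exists phi, [/\ C phi, convex_on `[a, b] phi &
    forall x, a <= x <= b -> u x <= phi x <= u x + delta].
Proof using Ccvx Cuniv.
move=> ab cu uc d0; have d20 : 0 < delta / 2 by rewrite divr_gt0.
have [||phi Cphi H] := Cuniv (g := fun x => u x + delta / 2) ab _ _ d20.
- by apply: within_continuousD uc _; exact: within_continuous_cst.
- by apply: convex_onD cu _; exact: convex_on_cst.
exists phi; split => //; first exact: convex_onS (Ccvx Cphi).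
move=> x xab; have := sup_norm_lt_pointwise H (z := x) xab.
by rewrite ltr_norml => /andP[h1 h2]; apply/andP; split; lra.
Qed.

Lemma class_approx_below (a b : R) (u : R -> R) (delta : R) : a <= b ->
  convex_on `[a, b] u -> {within `[a, b], continuous u} -> 0 < delta ->
  exists phi, [/\ C phi, convex_on `[a, b] phi &
    forall x, a <= x <= b -> u x - delta <= phi x <= u x].
Proof using Ccvx Cuniv.
move=> ab cu uc d0.
have [||phi [Cphi phic H]] := class_approx_above (u := fun x => u x - delta) ab _ _ d0.
- by apply: convex_onD cu _; exact: convex_on_cst.
- by apply: within_continuousD uc _; exact: within_continuous_cst.
by exists phi; split => // x /H; rewrite subrK.
Qed.

Lemma family_bounded (a b : R) (N : nat) (u : 'I_N -> R -> R) :
  (forall i, {within `[a, b], continuous (u i)}) ->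
  exists2 M : R, 0 <= M & forall i x, a <= x <= b -> `|u i x| <= M.
Proof.
move=> uc.
have /choice[M HM] i : exists M : R, 0 <= M /\ forall x, a <= x <= b -> `|u i x| <= M.
  have [M M0 H] := compact_bounded_fun (@segment_compact R a b) (uc i).
  by exists M; split => // x xab; apply: H; rewrite /= in_itv.
exists (\sum_i M i); first by apply: sumr_ge0 => i _; case: (HM i).
move=> i x xab; apply: (le_trans ((HM i).2 x xab)).
by rewrite (bigD1 i) //= lerDl sumr_ge0 // => j _; case: (HM j).
Qed.

Definition saddle_continuous (X Y : set R) (N : nat) (s : saddle_data R N) : Prop :=
  [/\ forall i, {within X, continuous (e_cvp s i)},
      forall i, {within Y, continuous (a_ccp s i)},
      forall i, {within X, continuous (e_cvm s i)},
      forall i, {within Y, continuous (a_cvp s i)} &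
      {within X, continuous (H_cv s)} /\ {within Y, continuous (G_cc s)}].

Lemma dist_above (u v delta : R) : u <= v <= u + delta -> `|u - v| <= delta.
Proof. by move=> /andP[h1 h2]; rewrite ler_norml; apply/andP; split; lra. Qed.

Lemma dist_below (u v delta : R) : u - delta <= v <= u -> `|u - v| <= delta.
Proof. by move=> /andP[h1 h2]; rewrite ler_norml; apply/andP; split; lra. Qed.

Lemma product_dist (M delta u u' v v' : R) : 0 <= delta <= 1 ->
  `|u| <= M -> `|v| <= M -> `|u - u'| <= delta -> `|v - v'| <= delta ->
  `|u * v - u' * v'| <= delta * (2 * M + 1).
Proof.
move=> /andP[d0 d1] uM vM uu vv.
have v'M : `|v'| <= M + 1.
  rewrite (_ : v' = v - (v - v')); last by ring.
  by rewrite (le_trans (ler_normB _ _)) // lerD // (le_trans vv).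
rewrite (_ : u * v - _ = u * (v - v') + (u - u') * v'); last by ring.
apply: (le_trans (ler_normD _ _)); rewrite !normrM.
apply: (@le_trans _ _ (M * delta + delta * (M + 1))).
  by rewrite lerD // ler_pM.
by rewrite le_eqVlt; apply/orP; left; apply/eqP; ring.
Qed.

(** Every component is replaced by an element of C on the side that its sign
    constraint demands; a concave component is approximated through its
    opposite, from below. *)
Lemma saddle_network_approx (a b c d : R) (N : nat) (s : saddle_data R N) (eps : R) :
  a <= b -> c <= d -> saddle_admissible `[a, b] `[c, d] s ->
  saddle_continuous `[a, b] `[c, d] s -> 0 < eps ->
  exists s' : saddle_data R N,
  [/\ saddle_admissible `[a, b] `[c, d] s', saddle_built_from C `[a, b] `[c, d] s' &
      forall x y, a <= x <= b -> c <= y <= d ->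
        `|saddle_eval s (x, y) - saddle_eval s' (x, y)| <= eps].
Proof using Ccvx Cuniv.
move=> ab cd [cvp ccp cvm cvy [Hcv Gcc]] [Cp Ccc Cm Cy [CH CG]] eps0.
have [M1 M10 B1] := family_bounded Cp; have [M2 M20 B2] := family_bounded Ccc.
have [M3 M30 B3] := family_bounded Cm; have [M4 M40 B4] := family_bounded Cy.
pose M := M1 + M2 + M3 + M4.
have [M1M M2M M3M M4M] : [/\ M1 <= M, M2 <= M, M3 <= M & M4 <= M].
  by clear -M10 M20 M30 M40; rewrite /M; split; lra.
(* Each of the 2 N products moves by at most delta (2 M + 1), and each of the
   two functions of one variable by at most delta. *)
pose K := 2 * N%:R * (2 * M + 1) + 2.
have K0 : 0 < K by rewrite ltr_wpDl // !mulr_ge0 // addr_ge0 // mulr_ge0 // !addr_ge0.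
pose delta := Num.min 1 (eps / K).
have d0 : 0 < delta by rewrite lt_min ltr01 divr_gt0.
have d1 : 0 <= delta <= 1 by rewrite ltW //= ge_min lexx.
have dK : delta * K <= eps by rewrite -ler_pdivlMr // ge_min lexx orbT.
have in_ab x : a <= x <= b -> `[a, b]%classic x by rewrite /= in_itv.
have in_cd y : c <= y <= d -> `[c, d]%classic y by rewrite /= in_itv.
have /choice[e1 E1] i := class_approx_above ab (cvp i).1 (Cp i) d0.
have /choice[k1 K1] i := class_approx_below cd (ccp i).1 (within_continuousN (Ccc i)) d0.
have /choice[e2 E2] i := class_approx_below ab (cvm i).1 (Cm i) d0.
have /choice[k2 K2] i := class_approx_above cd (cvy i).1 (Cy i) d0.
have [h [Ch hc hH]] := class_approx_above ab Hcv CH d0.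
have [g [Cg gc gG]] := class_approx_above cd Gcc (within_continuousN CG) d0.
exists (SaddleData e1 (fun i y => - k1 i y) e2 k2 h (fun y => - g y)); split.
- split => //=.
  + move=> i; have [_ ec eE] := E1 i; split=> // x xab.
    by have /andP[+ _] := eE x xab; apply: le_trans; exact: (cvp i).2.
  + move=> i; have [_ kc kE] := K1 i; split; first exact: concave_onN.
    move=> y ycd; have /andP[_] := kE y ycd.
    by rewrite oppr_ge0 => /le_trans; apply; rewrite oppr_le0; exact: (ccp i).2.
  + move=> i; have [_ ec eE] := E2 i; split=> // x xab.
    by have /andP[_] := eE x xab => /le_trans; apply; exact: (cvm i).2.
  + move=> i; have [_ ec eE] := K2 i; split=> // x xab.
    by have /andP[+ _] := eE x xab; apply: le_trans; exact: (cvy i).2.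
  + by split=> //; exact: concave_onN.
- split => /=.
  + by move=> i; exists (e1 i) => //; case: (E1 i).
  + by move=> i; exists (k1 i) => [|y _]; [case: (K1 i)|rewrite opprK].
  + by move=> i; exists (e2 i) => //; case: (E2 i).
  + by move=> i; exists (k2 i) => //; case: (K2 i).
  + by split; [exists h|exists g => // y _; rewrite opprK].
- move=> x y xab ycd; rewrite /saddle_eval /=.
  have hx : `|H_cv s x - h x| <= delta.
    exact/dist_above/hH.
  have gy : `|G_cc s y - - g y| <= delta.
    by rewrite -normrN opprB addrC; apply/dist_above/gG.
  have B1M i := le_trans (B1 i x xab) M1M; have B2M i := le_trans (B2 i y ycd) M2M.
  have B3M i := le_trans (B3 i x xab) M3M; have B4M i := le_trans (B4 i y ycd) M4M.
  have P1 i : `|e_cvp s i x * a_ccp s i y - e1 i x * - k1 i y| <= delta * (2 * M + 1).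
    have [_ _ e1x] := E1 i; have [_ _ k1y] := K1 i.
    apply: product_dist (B1M i) (B2M i) _ _ => //; first exact/dist_above/e1x.
    by rewrite -normrN opprB addrC; apply/dist_below/k1y.
  have P2 i : `|e_cvm s i x * a_cvp s i y - e2 i x * k2 i y| <= delta * (2 * M + 1).
    have [_ _ e2x] := E2 i; have [_ _ k2y] := K2 i.
    apply: product_dist (B3M i) (B4M i) _ _ => //; first exact/dist_below/e2x.
    exact/dist_above/k2y.
  have sumP (F F' : 'I_N -> R) : (forall i, `|F i - F' i| <= delta * (2 * M + 1)) ->
      `|\sum_i F i - \sum_i F' i| <= N%:R * (delta * (2 * M + 1)).
    move=> FF; rewrite -sumrB; apply: le_trans (ler_norm_sum _ _ _) _.
    apply: (@le_trans _ _ (\sum_(i < N) delta * (2 * M + 1))); first exact: ler_sum.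
    by rewrite sumr_const card_ord [leRHS]mulr_natl.
  have := sumP _ _ P1; have := sumP _ _ P2.
  set S1 := \sum_i e_cvp s i x * _; set S1' := \sum_i e1 i x * _.
  set S2 := \sum_i e_cvm s i x * _; set S2' := \sum_i e2 i x * _ => D2 D1.
  rewrite (_ : _ - _ = (S1 - S1') + (S2 - S2') + (H_cv s x - h x) + (G_cc s y - - g y));
    last by ring.
  apply: le_trans dK; rewrite (_ : delta * K = N%:R * (delta * (2 * M + 1)) +
    N%:R * (delta * (2 * M + 1)) + delta + delta); last by rewrite /K; ring.
  apply: (le_trans (ler_normD _ _)); rewrite lerD //.
  apply: (le_trans (ler_normD _ _)); rewrite lerD //.
  by apply: (le_trans (ler_normD _ _)); rewrite lerD.
Qed.

End Approximation.

(** * The two signs of the mixed condition *)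

Section Monge.
Context {R : realType}.

Lemma within_continuous_swap (f : R * R -> R) (X Y : set R) :
  {within X `*` Y, continuous f} ->
  {within Y `*` X, continuous (fun z => f (z.2, z.1))}.
Proof.
move=> /subspace_continuousP fc; apply/subspace_continuousP => -[y x] [/= Yy Xx].
apply/cvgrPdist_le => eta eta0.
have /cvgrPdist_le/(_ _ eta0) := fc (x, y) (conj Xx Yy).
rewrite !near_withinE => /nbhs_ballP[r /= r0 fr].
apply/nbhs_ballP; exists r => //= -[y' x'] [/= yy xx] [Yy' Xx'].
exact: (fr (x', y') (conj xx yy) (conj Xx' Yy')).
Qed.

(** On a degenerate box one of the two gaps is taken between equal points. *)
Lemma mixed_gap_le0_box (a b c d : R) (f : R * R -> R) : a <= b -> c <= d ->
  {within `[a, b] `*` `[c, d], continuous f} ->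
  mixed_monge_ge0 `[a, b] `[c, d] f ->
  forall t s p q r r', 0 <= t <= 1 -> 0 <= s <= 1 ->
  a <= p <= b -> a <= q <= b -> c <= r <= d -> c <= r' <= d ->
  jensen_gap t (fun x => jensen_gap s (fun y => f (x, y)) r r') p q <= 0.
Proof.
move=> ab cd fc fm t s p q r r' t01 s01 pab qab rcd r'cd.
have [abE|abN] := eqVneq a b.
  by have -> : p = q by [lra]; rewrite jensen_gap_diag.
have [cdE|cdN] := eqVneq c d.
  have -> : r = r' by lra.
  by under eq_fun do rewrite jensen_gap_diag; rewrite /jensen_gap; lra.
by apply: (mixed_gap_le0 _ _ fc fm) => //; rewrite lt_neqAle ?abN ?cdN.
Qed.

Definition continuous_saddle_data_near (a b c d : R) (f : R * R -> R) (eps : R)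
    (N : nat) (s : saddle_data R N) : Prop :=
  [/\ saddle_admissible `[a, b] `[c, d] s,
      saddle_continuous `[a, b] `[c, d] s &
      forall x y, a <= x <= b -> c <= y <= d -> `|f (x, y) - saddle_eval s (x, y)| <= eps].

Variables (a b c d : R) (f : R * R -> R).
Hypotheses (ab : a <= b) (cd : c <= d).
Hypothesis fc : {within `[a, b] `*` `[c, d], continuous f}.
Hypothesis fcv : forall y, `[c, d]%classic y -> convex_on `[a, b] (fun x => f (x, y)).
Hypothesis fcc : forall x, `[a, b]%classic x -> concave_on `[c, d] (fun y => f (x, y)).

Lemma monge_ge0_saddle (eps : R) : 0 < eps -> mixed_monge_ge0 `[a, b] `[c, d] f ->
  exists n (s : saddle_data R n.+1), continuous_saddle_data_near a b c d f eps s.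
Proof using ab cd fc fcv fcc.
move=> eps0 fm.
have [n [e [k [M [He Hk H]]]]] :=
  saddle_expansion ab cd fc fcv fcc (mixed_gap_le0_box ab cd fc fm) eps0.
exists n, (SaddleData e k (fun _ _ => 0) (fun _ _ => 0) (fun _ => - M) (fun _ => 0)).
have cst0 D : concave_on D (fun _ : R => 0) by apply: convex_on_cst.
split.
- split => /=; try by move=> i; split => //; exact: convex_on_cst.
  + by move=> i; have [ec _ e0] := He i; split.
  + by move=> i; have [kc _ k0] := Hk i; split.
  + by split=> //; exact: convex_on_cst.
- split => /=; try by move=> i; exact: within_continuous_cst.
  + by move=> i; case: (He i).
  + by move=> i; case: (Hk i).
  + by split; exact: within_continuous_cst.
- move=> x y xab ycd; rewrite /saddle_eval /= addr0.
  under [X in _ + X - _]eq_bigr do rewrite mulr0.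
  by rewrite sumr_const mul0rn addr0; exact: H.
Qed.

(** The function (y, x) |-> - f (x, y) is again convex-concave and satisfies the
    opposite inequality. Its expansion, read back, writes f as a sum of products
    of nonpositive convex functions of x by nonnegative convex functions of y. *)
Lemma monge_le0_saddle (eps : R) : 0 < eps -> mixed_monge_le0 `[a, b] `[c, d] f ->
  exists n (s : saddle_data R n.+1), continuous_saddle_data_near a b c d f eps s.
Proof using ab cd fc fcv fcc.
move=> eps0 /mixed_monge_le0N fm.
have fNc : {within `[a, b] `*` `[c, d], continuous (fun z => - f z)}.
  by move=> z; apply: continuousN; exact: fc.
have [||| n [e [k [M [He Hk H]]]]] :=
  saddle_expansion (f := fun z => - f (z.2, z.1)) cd ab (within_continuous_swap fNc) _ _ _ eps0.
- by move=> x xab; exact: fcc.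
- by move=> y ycd; apply: concave_onN; exact: fcv.
- move=> t s p q r r' t01 s01 pcd qcd rab r'ab /=.
  rewrite jensen_gap_swap; exact: (mixed_gap_le0_box ab cd fNc fm).
exists n, (SaddleData (fun _ _ => 0) (fun _ _ => 0) (fun i x => - k i x) e
  (fun _ => M) (fun _ => 0)).
have cst0 D : concave_on D (fun _ : R => 0) by apply: convex_on_cst.
split.
- split => /=; try by move=> i; split => //; exact: convex_on_cst.
  + move=> i; have [kc _ k0] := Hk i; split=> // x /= xab.
    by rewrite oppr_le0; exact: k0.
  + by move=> i; have [ec _ e0] := He i; split.
  + by split=> //; exact: convex_on_cst.
- split => /=; try by move=> i; exact: within_continuous_cst.
  + by move=> i; apply: within_continuousN; case: (Hk i).
  + by move=> i; case: (He i).
  + by split; exact: within_continuous_cst.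
- move=> x y xab ycd; rewrite /saddle_eval /= addr0.
  under [X in X + _ + _]eq_bigr do rewrite mulr0.
  rewrite sumr_const mul0rn add0r.
  have := H y x ycd xab; rewrite /= -normrN; congr (`|_| <= _).
  have -> : \sum_(i < n.+1) - k i x * e i y = - \sum_(i < n.+1) e i y * k i x.
    by rewrite -sumrN; apply: eq_bigr => i _; rewrite mulNr mulrC.
  by ring.
Qed.

End Monge.

(** * Density of saddle networks *)

Theorem theorem2 (R : realType) (a b c d : R) (hab : a <= b) (hcd : c <= d)
    (X : set R) (hX : X = `[a, b]%classic) (Y : set R) (hY : Y = `[c, d]%classic)
    (C : set (R -> R))
    (hCconvex : forall phi, C phi -> convex_on setT phi)
    (hCuniv : universal_approximator C)
    (f : R * R -> R)
    (hfcont : {within X `*` Y, continuous f})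
    (hfconvex : forall y, Y y -> convex_on X (fun x => f (x, y)))
    (hfconcave : forall x, X x -> concave_on Y (fun y => f (x, y)))
    (hfmixed : mixed_monge_ge0 X Y f \/ mixed_monge_le0 X Y f)
    (eps : R) (heps : 0 < eps) :
  (exists N h, [/\ (1 <= N)%N, saddle_network_class C X Y N h &
     (sup_norm_on (X `*` Y) (fun z => (f z - h z)%R) < eps%:E)%E]) /\
  (exists N h, [/\ (1 <= N)%N, bilinear_saddle_network_class C X Y N h &
     (sup_norm_on (X `*` Y) (fun z => (f z - h z)%R) < eps%:E)%E]).
Proof.
subst X Y; have eps40 : 0 < eps / 4 by rewrite divr_gt0.
have [n [s [sA sC sE]]] : exists n (s : saddle_data R n.+1),
    continuous_saddle_data_near a b c d f (eps / 4) s.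
  by case: hfmixed; [exact: monge_ge0_saddle|exact: monge_le0_saddle].
have [s' [s'A s'B s'E]] := saddle_network_approx hCconvex hCuniv hab hcd sA sC eps40.
have dist : (sup_norm_on (`[a, b] `*` `[c, d])
    (fun z => (f z - saddle_eval s' z)%R) < eps%:E)%E.
  apply: (@sup_norm_lt _ _ _ _ (eps / 2)); first lra.
  move=> [x y] [/=]; rewrite !in_itv /= => xab ycd.
  have := sE x y xab ycd; have := s'E x y xab ycd.
  move: (f _) (saddle_eval s _) (saddle_eval s' _) => A B D h1 h2.
  rewrite (_ : A - D = (A - B) + (B - D)); last by ring.
  by apply: le_trans (ler_normD _ _) _; lra.
have net : saddle_network_class C `[a, b] `[c, d] n.+1 (saddle_eval s').
  by split; [exists s'|exists s'].
split; exists n.+1, (saddle_eval s'); split=> //; split.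
- exists (saddle_eval s'), 0; split; first by case: net.
  by move=> z _; rewrite !mul0r addr0.
- by exists s', 0; split=> // z _; rewrite !mul0r addr0.
Qed.
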